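(* Partition $Z=(Z_1,Z_2)$ and correspondingly $\mathbf b^T=(\mathbf b_1^T,\mathbf b_2^T)$, with $\mathbf b_1$ and $\mathbf b_2$ independent (so $B$ is block diagonal). Assume that, along the sequence $(\lambda,\Sigma)=(\lambda_n,\Sigma_n)$: (C.1) the eigenvalues of $\Sigma\,(Z^T(I-\tilde A(\lambda))Z+\Sigma)^{-1}\Sigma$ are bounded from above (uniformly in $n$); (C.2) $nR_1(\lambda,\Sigma)\to\infty$ as $n\to\infty$; (C.5) $R_1(\lambda,\Sigma)-R_3(\lambda,\Sigma)=o(R_1(\lambda,\Sigma))$ as $n\to\infty$. Then, as $n\to\infty$, $$U(\lambda,\Sigma)-L_3(\lambda,\Sigma)-\frac1n\varepsilon^T\varepsilon=o_p(L_3(\lambda,\Sigma)).$$ If, in addition, (C.3) $\{n^{-1}\mathrm{tr}\,A(\lambda,\Sigma)\}^2/\{n^{-1}\mathrm{tr}\,A^2(\lambda,\Sigma)\}\to0$ as $n\to\infty$, then $$V(\lambda,\Sigma)-L_3(\lambda,\Sigma)-\frac1n\varepsilon^T\varepsilon=o_p(L_3(\lambda,\Sigma)).$$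
   Context: Model. For each $n$ one observes $Y_i=\eta(x_i)+\mathbf z_i^T\mathbf b+\varepsilon_i$, $i=1,\dots,n$, with fixed design points $x_i\in\mathcal X$ and $\mathbf z_i\in\mathbb R^p$, an unknown (nonrandom) function $\eta$ on $\mathcal X$, random effects $\mathbf b\sim N(\mathbf 0,B)$ in $\mathbb R^p$, and errors $\varepsilon_i\sim N(0,\sigma^2)$ independent of each other and of $\mathbf b$; $\sigma^2>0$ is fixed. The dimension $p$ may depend on $n$; the eigenvalues of the $p\times p$ matrix $B$ are bounded uniformly in $n$. Write $\mathbf Y=(Y_1,\dots,Y_n)^T$, $\boldsymbol\eta=(\eta(x_1),\dots,\eta(x_n))^T$, $\varepsilon=(\varepsilon_1,\dots,\varepsilon_n)^T$, and let $Z$ be the $n\times p$ matrix with rows $\mathbf z_i^T$, so $\mathbf Y=\boldsymbol\eta+Z\mathbf b+\varepsilon$. Estimator. Given functions $\xi_1,\dots,\xi_q$ on $\mathcal X$ ($q$ may depend on $n$) and a quadratic roughness functional $J$ (a square seminorm), let $R$ be the $n\times q$ matrix with entries $\xi_j(x_i)$ and $Q$ the $q\times q$ nonnegative definite matrix with entries $J(\xi_j,\xi_k)$. For $\lambda>0$ and a symmetric positive definite $p\times p$ matrix $\Sigma$ (both tuning parameters), one minimizes $(\mathbf Y-R\mathbf c-Z\mathbf b)^T(\mathbf Y-R\mathbf c-Z\mathbf b)+\mathbf b^T\Sigma\mathbf b+n\lambda\,\mathbf c^TQ\mathbf c$ over $\mathbf c,\mathbf b$. It is assumed throughout that the normal equations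 are solvable, i.e. the columns of $\binom{R^T}{Z^T}$ lie in the column space of $\begin{pmatrix}R^TR+n\lambda Q&R^TZ\\Z^TR&Z^TZ+\Sigma\end{pmatrix}$. $C^+$ denotes the Moore–Penrose inverse of $C$. The minimizer is $$\begin{pmatrix}\hat{\mathbf c}\\\hat{\mathbf b}\end{pmatrix}=\begin{pmatrix}R^TR+n\lambda Q&R^TZ\\Z^TR&Z^TZ+\Sigma\end{pmatrix}^{+}\begin{pmatrix}R^T\mathbf Y\\Z^T\mathbf Y\end{pmatrix},$$ $\hat{\boldsymbol\eta}=R\hat{\mathbf c}$, and $\hat{\mathbf b}^T=(\hat{\mathbf b}_1^T,\hat{\mathbf b}_2^T)$ is partitioned like $\mathbf b$. The smoothing matrix is $$A=A(\lambda,\Sigma)=(R,Z)\begin{pmatrix}R^TR+n\lambda Q&R^TZ\\Z^TR&Z^TZ+\Sigma\end{pmatrix}^{+}\begin{pmatrix}R^T\\Z^T\end{pmatrix},$$ so that the fitted values are $\hat{\mathbf Y}=R\hat{\mathbf c}+Z\hat{\mathbf b}=A\mathbf Y$, and $\tilde A(\lambda)=R(R^TR+n\lambda Q)^+R^T$ is the smoothing matrix when random effects are absent. Losses and risks. Let $P_{Z_2}^\perp=I-Z_2(Z_2^TZ_2)^+Z_2^T$. Put $$L_1(\lambda,\Sigma)=\frac1n\sum_{i=1}^n(\hat Y_i-\eta(x_i)-\mathbf z_i^T\mathbf b)^2,$$ $$L_3(\lambda,\Sigma)=\frac1n(\hat{\boldsymbol\eta}+Z_1\hat{\mathbf b}_1-\boldsymbol\eta-Z_1\mathbf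 b_1)^TP_{Z_2}^\perp(\hat{\boldsymbol\eta}+Z_1\hat{\mathbf b}_1-\boldsymbol\eta-Z_1\mathbf b_1),$$ $R_1=E[L_1]$, $R_3=E[L_3]$, with expectation over $\mathbf b$ and $\varepsilon$. ($Z_1$ or $Z_2$ may be nil.) Scores: $$U(\lambda,\Sigma)=\frac1n\mathbf Y^T(I-A)^2\mathbf Y+\frac2n\sigma^2\,\mathrm{tr}\,A,\qquad V(\lambda,\Sigma)=\frac{n^{-1}\mathbf Y^T(I-A)^2\mathbf Y}{\{n^{-1}\mathrm{tr}(I-A)\}^2}.$$ Asymptotics are as $n\to\infty$ along nonrandom sequences $(\lambda,\Sigma)=(\lambda_n,\Sigma_n)$; $X_n=o_p(W_n)$ means $X_n/W_n\to0$ in probability. *)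

(* Defs.v *)
From HB Require Import structures.
From mathcomp Require Import all_boot all_order all_algebra.
From mathcomp Require Import all_classical all_reals all_analysis.
Set Implicit Arguments.
Unset Strict Implicit.
Unset Printing Implicit Defensive.
Import Order.TTheory GRing.Theory Num.Theory.
Import numFieldNormedType.Exports.
Local Open Scope classical_set_scope.
Local Open Scope ring_scope.

Section Matrices.
Variable R : realType.

Definition qform n (M : 'M[R]_n) (v : 'cV[R]_n) : R := (v^T *m M *m v) 0 0.

Definition nonneg_definite n (M : 'M[R]_n) : Prop :=
  M^T = M /\ forall v, 0 <= qform M v.

Definition pos_definite n (M : 'M[R]_n) : Prop :=
  M^T = M /\ forall v, v != 0 -> 0 < qform M v.

Definition moore_penrose m n (C : 'M[R]_(m, n)) (G : 'M[R]_(n, m)) : Prop :=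
  [/\ C *m G *m C = C, G *m C *m G = G,
      (C *m G)^T = C *m G & (G *m C)^T = G *m C].

(* The Moore-Penrose inverse C^+; the default value 0 is never used, by
   mpinvP below. Not to be confused with the library's pinvmx, which is only
   some generalized inverse. *)
Definition mpinv m n (C : 'M[R]_(m, n)) : 'M[R]_(n, m) :=
  xget 0 [set G | moore_penrose C G].

Lemma moore_penrose_uniq m n (C : 'M[R]_(m, n)) (G G' : 'M[R]_(n, m)) :
  moore_penrose C G -> moore_penrose C G' -> G = G'.
Proof.
move=> [a1 a2 a3 a4] [b1 b2 b3 b4].
have eC : C *m G = C *m G'.
  rewrite -[LHS]a3 -[C in LHS]b1 -(mulmxA (C *m G') C) trmx_mul a3 b3.
  by rewrite mulmxA a1.
have eG : G *m C = G' *m C.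
  rewrite -[LHS]a4 -[C in LHS]b1 -(mulmxA C G' C) mulmxA trmx_mul a4 b4.
  by rewrite -mulmxA (mulmxA C) a1.
by rewrite -[LHS]a2 -mulmxA eC mulmxA eG.
Qed.

Lemma gram_unit m n (F : 'M[R]_(m, n)) : row_full F -> F^T *m F \in unitmx.
Proof.
move=> fF; rewrite -row_free_unit -kermx_eq0; apply/eqP/row_matrixP => i.
set u := row i _; rewrite row0.
have : u *m (F^T *m F) = 0 by rewrite /u -row_mul mulmx_ker row0.
move=> /(congr1 (fun v => (v *m u^T) 0 0)).
rewrite mul0mx mulmxA -[_ *m u^T]mulmxA -[F *m u^T]trmxK trmx_mul trmxK !mxE.
under eq_bigr do rewrite !mxE -expr2.
move=> /eqP; rewrite psumr_eq0 => [|? _]; last exact: sqr_ge0.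
move=> /allP h; have uF0 : u *m F^T = 0.
  apply/rowP => j; rewrite [RHS]mxE.
  have := h j (mem_index_enum j); rewrite /= sqrf_eq0 => /eqP <-.
  by rewrite !mxE.
have fF' : row_free F^T by rewrite /row_free mxrank_tr.
by apply: (row_free_inj fF'); rewrite uF0 mul0mx.
Qed.

Lemma mpinvP m n (C : 'M[R]_(m, n)) : moore_penrose C (mpinv C).
Proof.
apply: (@xgetPex _ 0 [set G | moore_penrose C G]).
have [r [F [G [CE fF fG]]]] : exists r (F : 'M[R]_(m, r)) (G : 'M[R]_(r, n)),
    [/\ C = F *m G, row_full F & row_free G].
  exists (\rank C), (col_base C), (row_base C).
  by rewrite mulmx_base col_base_full row_base_free.
have uF : F^T *m F \in unitmx by exact: gram_unit.
have uG : G *m G^T \in unitmx.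
  by rewrite -{1}[G]trmxK; apply: gram_unit; rewrite /row_full mxrank_tr.
pose S := invmx (F^T *m F); pose W := invmx (G *m G^T).
have sS : S^T = S by rewrite /S trmx_inv trmx_mul trmxK.
have sW : W^T = W by rewrite /W trmx_inv trmx_mul trmxK.
have SF : S *m F^T *m F = 1%:M by rewrite -mulmxA mulVmx.
have GW : G *m (G^T *m W) = 1%:M by rewrite mulmxA mulmxV.
exists (G^T *m W *m (S *m F^T)); rewrite /moore_penrose /= CE.
have CH : F *m G *m (G^T *m W *m (S *m F^T)) = F *m (S *m F^T).
  by rewrite -mulmxA (mulmxA G) GW mul1mx.
have HC : G^T *m W *m (S *m F^T) *m (F *m G) = G^T *m W *m G.
  by rewrite -mulmxA (mulmxA (S *m F^T)) SF mul1mx.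
rewrite CH HC; split.
- by rewrite -mulmxA (mulmxA (S *m F^T)) SF mul1mx.
- by rewrite -[LHS]mulmxA (mulmxA G) GW mul1mx.
- by rewrite !trmx_mul trmxK sS mulmxA.
- by rewrite !trmx_mul trmxK sW mulmxA.
Qed.

End Matrices.

Section Probability.
Local Open Scope ereal_scope.
Context {R : realType} d (T : measurableType d) (P : probability T R).

(* The law N(m, v), parametrized by the variance; a point mass if v = 0,
   a case in which normal_prob is a uniform distribution. *)
Definition normal_law (m v : R) (E : set R) : \bar R :=
  if v == 0%R then \d_m E else normal_prob m (Num.sqrt v) E.

Definition has_normal_law (X : T -> R) (m v : R) : Prop :=
  forall E : set R, measurable E -> P (X @^-1` E) = normal_law m v E.

Definition rvec p (b : 'I_p -> {RV P >-> R}) (w : T) : 'cV[R]_p :=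
  \col_j b j w.

(* N(0, B), B possibly singular: all linear forms u^T b are N(0, u^T B u). *)
Definition gaussian_vector p (b : 'I_p -> {RV P >-> R}) (B : 'M[R]_p) : Prop :=
  nonneg_definite B /\
  forall u : 'cV[R]_p,
    has_normal_law (fun w => (u^T *m rvec b w) 0%R 0%R) 0 (qform B u).

Definition sigma_of p (b : 'I_p -> {RV P >-> R}) : set (set T) :=
  g_sigma_preimage (fun j => b j : T -> R).

Definition independent (F G : set (set T)) : Prop :=
  forall E E', F E -> G E' -> P (E `&` E') = P E * P E'.

Definition mutually_independent (I : finType) (F : I -> set (set T)) : Prop :=
  forall (S : {set I}) (E : I -> set T), (forall i, i \in S -> F i (E i)) ->
    P (\bigcap_(i in [set i | i \in S]) E i) = \prod_(i in S) P (E i).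

(* The family (b, eps_1, ..., eps_n): None stands for the whole vector b. *)
Definition effects_errors p n (b : 'I_p -> {RV P >-> R})
    (eps : 'I_n -> {RV P >-> R}) (k : option 'I_n) : set (set T) :=
  if k is Some i then sigma_of (fun _ : 'I_1 => eps i) else sigma_of b.

End Probability.

(* X_n / W_n -> 0 in probability; the probability spaces may vary with n, and
   the points where W_n = 0, at which the quotient is undefined, count as
   exceptional. *)
Definition is_op (R : realType) (d : nat -> measure_display)
    (T : forall n, measurableType (d n)) (P : forall n, probability (T n) R)
    (X W : forall n, T n -> R) : Prop :=
  forall e : R, 0 < e ->
    (fun n => P n [set w | W n w = 0 \/ e < `|X n w / W n w|]) @ \oo --> 0%E.

(* A square seminorm J(f) = J(f, f) with finite values on a linear space H of
   functions, given through its bilinear form. *)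
Record square_seminorm (R : realType) (X : Type)
    (H : set (X -> R)) (J : (X -> R) -> (X -> R) -> R) : Prop := {
  dom0 : H 0;
  dom_lin : forall a f g, H f -> H g -> H (a *: f + g);
  form_sym : forall f g, H f -> H g -> J f g = J g f;
  form_lin : forall a f g h, H f -> H g -> H h ->
    J (a *: f + g) h = a * J f h + J g h;
  form_ge0 : forall f, H f -> 0 <= J f f
}.

(* Deterministic data at sample size n. *)
Record design (R : realType) (X : Type) (n : nat) := Design {
  point : 'I_n -> X;
  dim1 : nat;
  dim2 : nat;
  Z1 : 'M[R]_(n, dim1);
  Z2 : 'M[R]_(n, dim2);
  nbasis : nat;
  xi : 'I_nbasis -> X -> R
}.

Section MixedModel.
Context {R : realType} {X : Type}.
Variables (J : (X -> R) -> (X -> R) -> R) (eta : X -> R).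
Variables (n : nat) (D : design R X n).

Let p := (dim1 D + dim2 D)%N.
Let q := nbasis D.

Definition Zmx : 'M[R]_(n, p) := row_mx (Z1 D) (Z2 D).
Definition Rmx : 'M[R]_(n, q) := \matrix_(i, j) xi j (point D i).
Definition Qmx : 'M[R]_q := \matrix_(j, k) J (xi j) (xi k).
Definition etavec : 'cV[R]_n := \col_i eta (point D i).

Definition response (b : 'cV[R]_p) (e : 'cV[R]_n) : 'cV[R]_n :=
  etavec + Zmx *m b + e.

Definition proj_perp_Z2 : 'M[R]_n :=
  1%:M - Z2 D *m mpinv ((Z2 D)^T *m Z2 D) *m (Z2 D)^T.

(* The smoothing matrix in the absence of random effects. *)
Definition smoothing0_mx (lambda : R) : 'M[R]_n :=
  Rmx *m mpinv (Rmx^T *m Rmx + (n%:R * lambda) *: Qmx) *m Rmx^T.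

Section Estimator.
Variables (lambda : R) (Sigma : 'M[R]_p).

Definition normal_mx : 'M[R]_(q + p) :=
  block_mx (Rmx^T *m Rmx + (n%:R * lambda) *: Qmx) (Rmx^T *m Zmx)
           (Zmx^T *m Rmx)                          (Zmx^T *m Zmx + Sigma).

(* Inclusion of column spaces; (_ <= _)%MS compares row spaces, hence the
   transpositions. *)
Definition solvable_normal_eq : Prop :=
  ((col_mx Rmx^T Zmx^T)^T <= normal_mx^T)%MS.

Definition smoothing_mx : 'M[R]_n :=
  row_mx Rmx Zmx *m mpinv normal_mx *m col_mx Rmx^T Zmx^T.

Section Fit.
Variable Y : 'cV[R]_n.

Definition coef_hat : 'cV[R]_(q + p) :=
  mpinv normal_mx *m col_mx (Rmx^T *m Y) (Zmx^T *m Y).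
Definition c_hat : 'cV[R]_q := usubmx coef_hat.
Definition b_hat : 'cV[R]_p := dsubmx coef_hat.
Definition eta_hat : 'cV[R]_n := Rmx *m c_hat.
Definition Y_hat : 'cV[R]_n := Rmx *m c_hat + Zmx *m b_hat.

Lemma Y_hatE : Y_hat = smoothing_mx *m Y.
Proof.
rewrite /Y_hat /c_hat /b_hat -mul_row_col vsubmxK /coef_hat /smoothing_mx.
by rewrite -mul_col_mx !mulmxA.
Qed.

Definition score_U (sigma2 : R) : R :=
  n%:R^-1 * qform ((1%:M - smoothing_mx) *m (1%:M - smoothing_mx)) Y
  + 2 / n%:R * sigma2 * \tr smoothing_mx.

Definition score_V : R :=
  (n%:R^-1 * qform ((1%:M - smoothing_mx) *m (1%:M - smoothing_mx)) Y)
  / (n%:R^-1 * \tr (1%:M - smoothing_mx)) ^+ 2.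

End Fit.

Section Losses.
Variables (b : 'cV[R]_p) (e : 'cV[R]_n).
Let Y := response b e.

Definition loss1 : R :=
  n%:R^-1 *
  \sum_(i < n) (Y_hat Y i 0 - eta (point D i) - (row i Zmx *m b) 0 0) ^+ 2.

Definition loss3 : R :=
  n%:R^-1 *
  qform proj_perp_Z2
    (eta_hat Y + Z1 D *m usubmx (b_hat Y) - etavec - Z1 D *m usubmx b).

End Losses.

End Estimator.
End MixedModel.

Arguments Zmx {R X n} D.
Arguments Rmx {R X n} D.
Arguments Qmx {R X} J {n} D.
Arguments etavec {R X} eta {n} D.
Arguments response {R X} eta {n} D b e.
Arguments proj_perp_Z2 {R X n} D.
Arguments smoothing0_mx {R X} J {n} D lambda.
Arguments normal_mx {R X} J {n} D lambda Sigma.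
Arguments solvable_normal_eq {R X} J {n} D lambda Sigma.
Arguments smoothing_mx {R X} J {n} D lambda Sigma.
Arguments score_U {R X} J {n} D lambda Sigma Y sigma2.
Arguments score_V {R X} J {n} D lambda Sigma Y.
Arguments loss1 {R X} J eta {n} D lambda Sigma b e.
Arguments loss3 {R X} J eta {n} D lambda Sigma b e.

(* Main.v *)
Require Import Defs.
From HB Require Import structures.
From mathcomp Require Import all_boot all_order all_algebra.
From mathcomp Require Import all_classical all_reals all_analysis.
From mathcomp Require Import measurable_realfun.
From mathcomp Require Import ring lra.
Import Order.TTheory GRing.Theory Num.Theory.
Import numFieldNormedType.Exports.
Local Open Scope classical_set_scope.
Local Open Scope ring_scope.

(** Write [A] for the smoothing matrix, [N = 1 - A], [e] for the error vector and
    [t = N (eta + Z b) - A e], so that the fitted values miss the truth by [- t].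
    Then [n L1 = |t|^2], and since [N Y = t + e],

      [n (U - L1 - e'e / n) = 2 (t'e + sigma^2 tr A)].

    Both sides of the problem are therefore quadratic in the jointly Gaussian
    vector [(b, e)], and everything reduces to first and second moments of
    bilinear forms [(F x)'(G x)] of such a vector ([dot_moments]).  With
    [M = cov t = N Z B Z' N + sigma^2 A^2] and [v = N eta] one gets

      [n R1 = |v|^2 + tr M],   [var (n L1) <= 8 kappa n R1],
      [E (n (U - L1 - e'e / n))^2 <= 16 sigma^2 n R1],

    where [kappa] bounds the spectrum of [M].  As [n R1] tends to infinity, both
    [L1 - R1] and [U - L1 - e'e / n] are [o_p(R1)] by Chebyshev's inequality.

    The number [kappa] is bounded in [n] because the eigenvalues of [B] and of
    [Sigma (W + Sigma)^-1 Sigma] are.  Indeed the normal equations give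
    [N Z = (1 - A0) Z T] with [T = (W + Sigma)^-1 Sigma] and
    [W = Z' (1 - A0) Z], whence [|N Z a|^2 <= a' Sigma (W + Sigma)^-1 Sigma a]
    because [1 - A0] lies between [0] and [1] ([residual_random_effects]).

    [L3] is [L1] seen through the orthogonal projection that kills [Z2], so
    [0 <= L3 <= L1], and [R1 - R3 = o(R1)] with Markov's inequality gives
    [L1 - L3 = o_p(R1)].  Hence [L3 = R1 (1 + o_p(1))], which lets [o_p(R1)] be
    replaced by [o_p(L3)] ([is_op_of_negl]), and the claim on [U] follows.

    For [V], put [m = tr A / n] and [m2 = tr A^2 / n].  Then
    [V - U = al (U - sigma^2) - be] with [al] of the order of [m] and [be] of the
    order of [m^2].  From [m^2 / m2 -> 0] one gets [m -> 0], because [m2 <= m] by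
    [A^2 <= A], and [m^2 = o(R1)], because [sigma^2 m2 <= R1]; both corrections are then
    [o_p(R1)] ([V_is_op]).

    The Gaussian input is used only through moments of order at most four: they
    are computed for the normal law by integration by parts, propagated to all
    linear forms of [(b, e)] through independence, and polarized into the formula
    of Isserlis ([wick4]). *)

Set Implicit Arguments.
Unset Strict Implicit.
Unset Printing Implicit Defensive.

(** * Quadratic forms of symmetric matrices *)

Section Forms.
Variable R : realType.

Definition dot n (u v : 'cV[R]_n) : R := (u^T *m v) 0 0.

Lemma dotE n (u v : 'cV[R]_n) : dot u v = \sum_i u i 0 * v i 0.
Proof. by rewrite /dot mxE; apply: eq_bigr => i _; rewrite mxE. Qed.

Lemma dotC n (u v : 'cV[R]_n) : dot u v = dot v u.
Proof. by rewrite !dotE; apply: eq_bigr => i _; rewrite mulrC. Qed.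

Lemma dotDl n (u v w : 'cV[R]_n) : dot (u + v) w = dot u w + dot v w.
Proof. by rewrite /dot linearD mulmxDl mxE. Qed.

Lemma dotDr n (u v w : 'cV[R]_n) : dot u (v + w) = dot u v + dot u w.
Proof. by rewrite /dot mulmxDr mxE. Qed.

Lemma dotZl n a (u v : 'cV[R]_n) : dot (a *: u) v = a * dot u v.
Proof. by rewrite /dot linearZ -scalemxAl mxE. Qed.

Lemma dotZr n a (u v : 'cV[R]_n) : dot u (a *: v) = a * dot u v.
Proof. by rewrite dotC dotZl dotC. Qed.

Lemma dotNl n (u v : 'cV[R]_n) : dot (- u) v = - dot u v.
Proof. by rewrite -scaleN1r dotZl mulN1r. Qed.

Lemma dotNr n (u v : 'cV[R]_n) : dot u (- v) = - dot u v.
Proof. by rewrite dotC dotNl dotC. Qed.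

Lemma dot_mull m n (M : 'M[R]_(m, n)) u v : dot (M *m u) v = dot u (M^T *m v).
Proof. by rewrite /dot trmx_mul mulmxA. Qed.

Lemma dot_mulr m n (M : 'M[R]_(m, n)) u v : dot u (M *m v) = dot (M^T *m u) v.
Proof. by rewrite dot_mull trmxK. Qed.

Lemma dot_ge0 n (u : 'cV[R]_n) : 0 <= dot u u.
Proof. by rewrite dotE sumr_ge0// => i _; rewrite -expr2 sqr_ge0. Qed.

Lemma dot_eq0 n (u : 'cV[R]_n) : (dot u u == 0) = (u == 0).
Proof.
apply/idP/eqP => [|->]; last by rewrite /dot mulmx0 mxE.
rewrite dotE psumr_eq0 => [/allP h|i _]; last by rewrite -expr2 sqr_ge0.
apply/colP => i; have := h i (mem_index_enum i).
by rewrite mxE /= -expr2 sqrf_eq0 => /eqP.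
Qed.

Lemma qformE n (M : 'M[R]_n) v : qform M v = dot v (M *m v).
Proof. by rewrite /qform /dot mulmxA. Qed.

Lemma qformD n (M M' : 'M[R]_n) v : qform (M + M') v = qform M v + qform M' v.
Proof. by rewrite !qformE mulmxDl dotDr. Qed.

Lemma qform_sqr n (M : 'M[R]_n) v : M^T = M ->
  qform (M *m M) v = dot (M *m v) (M *m v).
Proof. by move=> sM; rewrite qformE -mulmxA dot_mulr sM. Qed.

Lemma mxtrace_dot n (M : 'M[R]_n) :
  \tr M = \sum_i dot (delta_mx i 0) (M *m delta_mx i 0).
Proof.
apply: eq_bigr => i _; rewrite -colE dotE (bigD1 i)//= big1 ?addr0.
  by rewrite !mxE !eqxx mul1r.
by move=> j ji; rewrite !mxE (negPf ji) mul0r.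
Qed.

(** Nonnegativity of [M] on the span of [u] and [v]. When [v] is isotropic the
    quadratic in question degenerates to an affine function, which can only stay
    nonnegative if its slope vanishes. *)
Lemma cauchy_schwarz_form n (M : 'M[R]_n) u v : nonneg_definite M ->
  dot u (M *m v) ^+ 2 <= qform M u * qform M v.
Proof.
move=> [sM M0].
have q2 a b : qform M (a *: u + b *: v) =
    a ^+ 2 * qform M u + 2 * a * b * dot u (M *m v) + b ^+ 2 * qform M v.
  rewrite !qformE mulmxDr !dotDl !dotDr -!scalemxAr !dotZl !dotZr.
  have -> : dot v (M *m u) = dot u (M *m v) by rewrite dot_mulr sM dotC.
  ring.
have := M0 v; rewrite le_eqVlt => /predU1P[c0|c0].
  have [->|b0] := eqVneq (dot u (M *m v)) 0; first by rewrite expr0n/= -c0 mulr0.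
  (* At this multiple of v the form would take the value - 1. *)
  have := M0 (1 *: u + (- (qform M u + 1) / (2 * dot u (M *m v))) *: v).
  rewrite q2 -c0 mulr0 addr0 expr1n mul1r mulr1.
  rewrite (_ : 2 * _ * _ = - (qform M u + 1)); last by field.
  lra.
have := M0 (qform M v *: u + (- dot u (M *m v)) *: v).
rewrite q2 (_ : _ + _ = qform M v *
  (qform M u * qform M v - dot u (M *m v) ^+ 2)); last by ring.
by rewrite pmulr_rge0// subr_ge0.
Qed.

Lemma nonneg_definite1 n : nonneg_definite (1%:M : 'M[R]_n).
Proof. by split=> [|v]; [exact: trmx1|rewrite qformE mul1mx dot_ge0]. Qed.

Lemma nonneg_definite0 n : nonneg_definite (0 : 'M[R]_n).
Proof. by split=> [|v]; [exact: trmx0|rewrite qformE mul0mx /dot mulmx0 mxE]. Qed.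

Lemma cauchy_schwarz n (u v : 'cV[R]_n) : dot u v ^+ 2 <= dot u u * dot v v.
Proof.
have := cauchy_schwarz_form u v (nonneg_definite1 n).
by rewrite !qformE !mul1mx.
Qed.

(** This is [M^2 <= k M] for [0 <= M <= k], read off Cauchy-Schwarz for the form
    [M] at the pair [(M v, v)]; no square root or diagonalization of [M] is taken. *)
Lemma norm_mul_form_le n (M : 'M[R]_n) (k : R) v : nonneg_definite M ->
  (forall v, qform M v <= k * dot v v) ->
  dot (M *m v) (M *m v) <= k * qform M v.
Proof.
move=> M0 Mk; have := cauchy_schwarz_form (M *m v) v M0.
have := Mk (M *m v); set a := dot (M *m v) (M *m v) => h1 h2.
have q0 : 0 <= qform M v by case: M0 => _ /(_ v).
have := dot_ge0 (M *m v); rewrite -/a le_eqVlt => /predU1P[a0|a0].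
  have := dot_ge0 v; rewrite -a0 le_eqVlt => /predU1P[v0|v0].
    have /eqP := esym v0; rewrite dot_eq0 => /eqP ->.
    by rewrite qformE /dot mulmx0 trmx0 mul0mx mxE mulr0.
  rewrite mulr_ge0// -(pmulr_lge0 _ v0); exact: le_trans (Mk v).
rewrite -(ler_pM2l a0) -expr2; apply: (le_trans h2).
by rewrite mulrCA mulrA ler_wpM2r.
Qed.

Lemma mxtrace_sqr_le n (M : 'M[R]_n) (k : R) : nonneg_definite M ->
  (forall v, qform M v <= k * dot v v) -> \tr (M *m M) <= k * \tr M.
Proof.
move=> M0 Mk; rewrite !mxtrace_dot mulr_sumr; apply: ler_sum => i _.
rewrite -mulmxA dot_mulr (proj1 M0) -qformE; exact: norm_mul_form_le.
Qed.

(** Cauchy-Schwarz at [v] and [F (F^T v)]. *)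
Lemma norm_mul_tr_le m n (F : 'M[R]_(m, n)) (k : R) : 0 <= k ->
  (forall v, dot (F *m v) (F *m v) <= k * dot v v) ->
  forall v, dot (F^T *m v) (F^T *m v) <= k * dot v v.
Proof.
move=> k0 Fk v; set a := dot (F^T *m v) _.
have := cauchy_schwarz v (F *m (F^T *m v)); rewrite dot_mulr -/a => h.
have [a0|a0] := eqVneq a 0; first by rewrite a0 mulr_ge0 ?dot_ge0.
have {}a0 : 0 < a by rewrite lt_neqAle eq_sym a0 dot_ge0.
rewrite -(ler_pM2r a0) -expr2 (le_trans h)//.
by rewrite [leRHS]mulrAC [leRHS]mulrC ler_wpM2l ?dot_ge0.
Qed.

Lemma qform_bounded n (M : 'M[R]_n) :
  exists2 c : R, 0 < c & forall v, qform M v <= c * dot v v.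
Proof.
pose c : R := \sum_i \sum_j `|M i j|.
have c0 : 0 <= c by rewrite sumr_ge0// => i _; rewrite sumr_ge0.
have coord (v : 'cV[R]_n) i : v i 0 ^+ 2 <= dot v v.
  rewrite dotE (bigD1 i)//= -expr2 lerDl sumr_ge0// => j _.
  by rewrite -expr2 sqr_ge0.
exists (c + 1) => [|v]; first by rewrite ltr_wpDl.
apply: (@le_trans _ _ (c * dot v v)); last by rewrite ler_wpM2r ?dot_ge0// lerDl.
rewrite qformE dotE mulr_suml; apply: ler_sum => i _.
rewrite mxE mulr_sumr mulr_suml; apply: ler_sum => j _.
rewrite mulrCA (le_trans (ler_norm _))// normrM ler_wpM2l//.
have := coord v i; have := coord v j.
have := sqr_ge0 (v i 0 - v j 0); have := sqr_ge0 (v i 0 + v j 0).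
by case: (ler0P (v i 0 * v j 0)); nra.
Qed.

(** The supremum [a] of the Rayleigh quotients must be an eigenvalue: otherwise
    [a - M] is invertible and nonnegative definite, hence bounded below by a
    positive multiple of the identity, and [a] could be lowered. *)
Lemma qform_le_eigenvalue n (M : 'M[R]_n) (k : R) : M^T = M ->
  (forall a, eigenvalue M a -> a <= k) ->
  forall v, qform M v <= k * dot v v.
Proof.
move=> sM Mk v0; rewrite leNgt; apply/negP => v0k.
have pos (v : 'cV[R]_n) : v != 0 -> 0 < dot v v.
  by move=> v0'; rewrite lt_neqAle eq_sym dot_eq0 v0' dot_ge0.
have nzv0 : v0 != 0.
  apply: contraTneq v0k => ->.
  by rewrite qformE /dot !mulmx0 !mxE mulr0 ltxx.
pose S := [set r | exists2 v, v != 0 & r = qform M v / dot v v].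
have supS : has_sup S.
  split; first by exists (qform M v0 / dot v0 v0), v0.
  have [c _ Mc] := qform_bounded M; exists c => _ [v /pos nzv ->].
  by rewrite ler_pdivrMr.
pose a := sup S.
have Ma v : qform M v <= a * dot v v.
  have [->|nzv] := eqVneq v 0.
    by rewrite qformE /dot !mulmx0 !mxE mulr0.
  by rewrite -ler_pdivrMr ?pos//; apply: sup_upper_bound => //; exists v.
have ka : k < a.
  by rewrite -(ltr_pM2r (pos _ nzv0)); apply: lt_le_trans v0k (Ma _).
pose N := a%:M - M.
have sN : N^T = N by rewrite linearB /= tr_scalar_mx sM.
have qN v : qform N v = a * dot v v - qform M v.
  by rewrite !qformE mulmxBl mul_scalar_mx dotDr dotNr dotZr.
have N0 : nonneg_definite N by split=> // v; rewrite qN subr_ge0.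
have uN : N \in unitmx.
  have : ~~ eigenvalue M a by apply/negP => /Mk; rewrite leNgt ka.
  rewrite /eigenvalue /eigenspace negbK kermx_eq0 row_free_unit => uM.
  by rewrite /N -opprB -scaleN1r unitmxZ ?unitrN1 ?unitrN ?unitr1.
have [c c0 Nc] := qform_bounded (invmx N).
(* Cauchy-Schwarz at v and N^-1 v turns an upper bound on N^-1 into a lower one on N. *)
have Nlb v : dot v v <= c * qform N v.
  have [->|/pos nzv] := eqVneq v 0.
    by rewrite qformE /dot !mulmx0 !mxE mulr0.
  have := cauchy_schwarz_form v (invmx N *m v) N0.
  rewrite mulmxA mulmxV// mul1mx [X in _ * X]qformE mulmxA mulmxV// mul1mx.
  rewrite (dotC (_ *m _)) -qformE => h.
  rewrite -(ler_pM2r nzv) -expr2 (le_trans h)// [leRHS]mulrAC [leRHS]mulrC.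
  by rewrite ler_wpM2l ?Nc//; case: N0.
suff : a <= a - c^-1 by rewrite lerDl oppr_ge0 leNgt invr_gt0 c0.
apply: sup_le_ub; first by case: supS.
move=> _ [v /pos nzv ->]; rewrite ler_pdivrMr// mulrBl lerBrDr addrC -lerBrDr.
rewrite -qN -(ler_pM2l c0) mulrA mulfV ?gt_eqF// mul1r; exact: Nlb.
Qed.

(** * Hat matrices of penalized least squares *)

(** Symmetric matrices with spectrum in [[0, 1]], encoded as [S^2 <= S]. *)
Definition shrinking n (S : 'M[R]_n) : Prop :=
  S^T = S /\ forall y, dot (S *m y) (S *m y) <= dot y (S *m y).

Lemma shrinking_nonneg n (S : 'M[R]_n) : shrinking S -> nonneg_definite S.
Proof.
by move=> [sS hS]; split=> // y; rewrite qformE (le_trans _ (hS y))// dot_ge0.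
Qed.

(** [(1 - S) - (1 - S)^2 = S - S^2]. *)
Lemma shrinking_compl n (S : 'M[R]_n) : shrinking S -> shrinking (1%:M - S).
Proof.
move=> [sS hS]; split=> [|y]; first by rewrite linearB /= trmx1 sS.
rewrite mulmxBl mul1mx [leLHS]dotDl dotNl gerDl oppr_le0 dotDr dotNr.
by rewrite (dotC _ y) subr_ge0.
Qed.

Lemma shrinking_norm_le n (S : 'M[R]_n) y : shrinking S ->
  dot (S *m y) (S *m y) <= dot y y.
Proof.
move=> shS; apply: le_trans (proj2 shS y) _.
have /shrinking_nonneg[_ /(_ y)] := shrinking_compl shS.
by rewrite qformE mulmxBl mul1mx dotDr dotNr subr_ge0.
Qed.

Lemma mpinv_sym n (G : 'M[R]_n) : G^T = G -> (mpinv G)^T = mpinv G.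
Proof.
move=> sG; have [h1 h2 h3 h4] := mpinvP G.
apply: (@moore_penrose_uniq _ _ _ G); last exact: mpinvP.
split.
- by rewrite -[in RHS]sG -[in RHS]h1 !trmx_mul sG mulmxA.
- by rewrite -[in RHS]h2 !trmx_mul sG mulmxA.
- by rewrite -{1 3}sG -!trmx_mul trmxK h4.
- by rewrite -{2 4}sG -!trmx_mul trmxK h3.
Qed.

(** The hat matrix of a least squares fit with penalty [c' D c]. *)
Definition ridge n q (X : 'M[R]_(n, q)) (D : 'M[R]_q) : 'M[R]_n :=
  X *m mpinv (X^T *m X + D) *m X^T.

Section Ridge.
Variables (n q : nat) (X : 'M[R]_(n, q)) (D : 'M[R]_q).
Hypothesis D0 : nonneg_definite D.
Let G := X^T *m X + D.

Let sG : G^T = G.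
Proof. by rewrite /G linearD /= trmx_mul trmxK (proj1 D0). Qed.

(** The kernel of [G = X^T X + D] is contained in that of [X], as both summands
    are nonnegative definite; so [X] is unchanged by the projection [G^+ G] along
    this kernel. *)
Lemma mul_mpinv_gram : X *m mpinv G *m G = X.
Proof.
have [h1 _ _ _] := mpinvP G.
apply/eqP; rewrite -subr_eq0 -[X in _ - X]mulmx1 -mulmxA -mulmxBr; apply/eqP.
set E := _ - 1%:M.
have GE : G *m E = 0 by rewrite /E mulmxBr mulmx1 mulmxA h1 subrr.
apply/matrixP => i j; rewrite [RHS]mxE.
have -> : (X *m E) i j = (X *m (E *m delta_mx j (0 : 'I_1))) i 0.
  by rewrite mulmxA -colE [RHS]mxE.
set u := E *m _; suff -> : X *m u = 0 by rewrite mxE.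
apply/eqP; rewrite -dot_eq0 eq_le dot_ge0 andbT.
have : dot u (G *m u) = 0 by rewrite /u (mulmxA G) GE mul0mx /dot mulmx0 mxE.
rewrite /G mulmxDl dotDr -mulmxA -dot_mull => <-.
by rewrite lerDl -qformE (proj2 D0).
Qed.

(** The fit depends only on the normal equations, not on the solution chosen. *)
Lemma ridge_solution m (y : 'M[R]_(n, m)) c :
  G *m c = X^T *m y -> ridge X D *m y = X *m c.
Proof. by move=> h; rewrite -mulmxA -h mulmxA mul_mpinv_gram. Qed.

(** With [G c = X^T y], the gap [y' A y - |A y|^2] is the penalty [c' D c]. *)
Lemma ridge_shrinking : shrinking (ridge X D).
Proof.
have sH := mpinv_sym sG; split.
  by rewrite /ridge !trmx_mul trmxK sH mulmxA.
move=> y; pose c := mpinv G *m (X^T *m y).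
have eG : G *m c = X^T *m y.
  rewrite /c !mulmxA; congr (_ *m _).
  by rewrite -[RHS](congr1 trmx mul_mpinv_gram) !trmx_mul sH sG mulmxA.
rewrite (ridge_solution eG) [leRHS]dot_mulr -eG /G mulmxDl dotDl.
by rewrite -mulmxA -dot_mulr lerDl dotC -qformE (proj2 D0).
Qed.
End Ridge.

Section RandomEffects.
Variables (n q p : nat) (F : 'M[R]_(n, q)) (Z : 'M[R]_(n, p)).
Variables (D : 'M[R]_q) (Sigma : 'M[R]_p).
Hypotheses (D0 : nonneg_definite D) (Sigma0 : pos_definite Sigma).
Let N0 : 'M[R]_n := 1%:M - ridge F D.
Let W := Z^T *m N0 *m Z.
Let N : 'M[R]_n := 1%:M - ridge (row_mx F Z) (block_mx D 0 0 Sigma).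

Let N0_shrinking : shrinking N0.
Proof. by apply: shrinking_compl; apply: ridge_shrinking. Qed.

Lemma block_nonneg_definite : nonneg_definite (block_mx D 0 0 Sigma).
Proof.
case: D0 Sigma0 => sD hD [sS hS]; split.
  by rewrite tr_block_mx !trmx0 sD sS.
move=> v; rewrite -[v]vsubmxK qformE mul_block_col !mul0mx addr0 add0r.
rewrite /dot tr_col_mx mul_row_col mxE -!/(dot _ _) -!qformE addr_ge0//.
have [->|/hS/ltW//] := eqVneq (dsubmx v) 0.
by rewrite qformE /dot !mulmx0 mxE.
Qed.

Let qW u : qform W u = dot (Z *m u) (N0 *m (Z *m u)).
Proof. by rewrite qformE /W -!mulmxA dot_mull. Qed.

Let qW0 u : 0 <= qform W u.
Proof.
by rewrite qW -qformE; case: (shrinking_nonneg N0_shrinking).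
Qed.

Lemma W_Sigma_unit : W + Sigma \in unitmx.
Proof.
rewrite -unitmx_tr -row_free_unit -kermx_eq0.
apply/eqP/row_matrixP => i; rewrite row0; set u := row i _.
have : u *m (W + Sigma)^T = 0 by rewrite /u -row_mul mulmx_ker row0.
move=> /(congr1 trmx); rewrite trmx_mul trmxK trmx0 => h.
apply: trmx_inj; rewrite trmx0; apply/eqP/negP => /negP nz.
have /(congr1 (dot u^T)) := h; rewrite mulmxDl dotDr -!qformE /dot mulmx0 mxE.
by apply/eqP; rewrite gt_eqF// ltr_wpDl ?(proj2 Sigma0).
Qed.

Lemma W_Sigma_sym : (Sigma *m invmx (W + Sigma) *m Sigma)^T =
  Sigma *m invmx (W + Sigma) *m Sigma.
Proof.
case: Sigma0 => sS _; have sW : W^T = W.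
  by rewrite /W !trmx_mul trmxK (proj1 N0_shrinking) mulmxA.
by rewrite !trmx_mul trmx_inv linearD /= sW sS mulmxA.
Qed.

(** Guess of the solution: fitting [Z a] by [R c + Z beta] with [beta = a - T a] leaves
    the residual [Z T a - R c], so the best [c] smooths [Z T a] in the absence of
    random effects. It then suffices to check the normal equations. *)
Lemma residual_random_effects :
  N *m Z = N0 *m Z *m (invmx (W + Sigma) *m Sigma).
Proof.
have h1 : D *m mpinv (F^T *m F + D) *m F^T = F^T *m N0.
  have sG : (F^T *m F + D)^T = F^T *m F + D.
    by rewrite linearD /= trmx_mul trmxK (proj1 D0).
  rewrite /N0 /ridge mulmxBr mulmx1; apply/eqP; rewrite eq_sym subr_eq.
  rewrite !mulmxA addrC -!mulmxDl -{1}(congr1 trmx (mul_mpinv_gram F D0)).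
  by rewrite !trmx_mul sG (mpinv_sym sG) !mulmxA.
set T : 'M[R]_p := invmx (W + Sigma) *m Sigma.
have hT : W *m T + Sigma *m T = Sigma.
  by rewrite -mulmxDl /T mulmxA mulmxV ?W_Sigma_unit// mul1mx.
pose c := col_mx (mpinv (F^T *m F + D) *m F^T *m Z *m T) (1%:M - T).
have Xc : row_mx F Z *m c = Z - N0 *m Z *m T.
  rewrite /c mul_row_col mulmxBr mulmx1 /N0 !mulmxBl mul1mx /ridge !mulmxA.
  by rewrite opprB addrC addrA addrAC.
rewrite /N mulmxBl mul1mx (@ridge_solution _ _ _ _ block_nonneg_definite _ Z c).
  by rewrite Xc opprB addrCA subrr addr0.
rewrite mulmxDl -mulmxA Xc mulmxBr -[RHS]addr0 -addrA; congr (_ + _).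
apply/eqP; rewrite addrC subr_eq0 /c mul_block_col !mul0mx addr0 add0r.
rewrite tr_row_mx mul_col_mx; apply/eqP; congr col_mx.
- by rewrite !mulmxA h1.
- by rewrite mulmxBr mulmx1 -{1}hT addrK /W !mulmxA.
Qed.

(** [|N Z a|^2 <= (T a)' W (T a) <= (T a)' (W + Sigma) (T a)
    = a' Sigma (W + Sigma)^-1 Sigma a]. *)
Lemma residual_random_effects_le (k : R) :
  (forall a, eigenvalue (Sigma *m invmx (W + Sigma) *m Sigma) a -> a <= k) ->
  forall v, dot (N *m Z *m v) (N *m Z *m v) <= k * dot v v.
Proof.
move=> hk v; apply: le_trans (qform_le_eigenvalue W_Sigma_sym hk v).
rewrite residual_random_effects; set T : 'M[R]_p := invmx _ *m Sigma.
have -> : N0 *m Z *m T *m v = N0 *m (Z *m (T *m v)) by rewrite !mulmxA.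
apply: le_trans (proj2 N0_shrinking _) _.
rewrite -qW (@le_trans _ _ (qform (W + Sigma) (T *m v)))//.
  rewrite qformD lerDl.
  by have [->|/(proj2 Sigma0)/ltW//] := eqVneq (T *m v) 0;
    rewrite qformE /dot !mulmx0 mxE.
rewrite qformE mulmxA /T (mulmxA (W + Sigma)) mulmxV ?W_Sigma_unit// mul1mx.
by rewrite qformE -!mulmxA dotC dot_mull (proj1 Sigma0).
Qed.
End RandomEffects.

(** [v^T Q v = J f f] for [f] the combination of the basis functions with
    coefficients [v]. *)
Lemma Qmx_nonneg_definite (X : Type) (H : set (X -> R))
    (J : (X -> R) -> (X -> R) -> R) n (D : design R X n) :
  square_seminorm H J -> (forall j : 'I_(nbasis D), H (xi j)) ->
  nonneg_definite (Qmx J D).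
Proof.
move=> HJ Hxi; split.
  by apply/matrixP => i j; rewrite !mxE (form_sym HJ).
move=> v; pose f s := \sum_(j <- s) v j 0 *: xi (d := D) j.
have Hf s : H (f s).
  elim: s => [|j s IH]; first by rewrite /f big_nil; exact: (dom0 HJ).
  by rewrite /f big_cons; apply: (dom_lin HJ).
have Jl s h : H h -> J (f s) h = \sum_(j <- s) v j 0 * J (xi j) h.
  move=> Hh; elim: s => [|j s IH].
    rewrite /f !big_nil; have := form_lin HJ 1 (dom0 HJ) (dom0 HJ) Hh.
    by rewrite scale1r addr0 mul1r => /eqP; rewrite -subr_eq subrr eq_sym => /eqP.
  rewrite /f !big_cons (form_lin HJ) ?IH//; exact: Hf.
suff -> : qform (Qmx J D) v = J (f (index_enum _)) (f (index_enum _)).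
  exact: (form_ge0 HJ).
rewrite qformE dotE Jl//; apply: eq_bigr => i _; congr (_ * _).
rewrite (form_sym HJ)// Jl// mxE; apply: eq_bigr => j _.
by rewrite mxE mulrC (form_sym HJ).
Qed.
End Forms.

(** * Moments of the normal law *)

Section NormalMoments.
Variables (R : realType) (s : R).
Hypothesis s0 : 0 < s.
Notation mu := (@lebesgue_measure R).
Let pdf := normal_pdf 0 s.

Lemma ge0_integral_normal_prob (f : R -> R) : (forall x, 0 <= f x) ->
  measurable_fun setT f ->
  (\int[normal_prob 0 s]_x (f x)%:E = \int[mu]_x (f x * normal_pdf 0 s x)%:E)%E.
Proof.
move=> f0 mf; have dom := @normal_prob_dominates R 0 s.
rewrite -(Radon_Nikodym_SigmaFinite.change_of_variables dom)//=; last first.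
  exact/measurable_EFinP.
under [RHS]eq_integral do rewrite EFinM.
have mpdf : measurable_fun setT (EFin \o normal_pdf (0 : R) s).
  by apply/measurable_EFinP; exact: measurable_normal_pdf.
have irn := Radon_Nikodym_SigmaFinite.f_integrable dom.
apply: ae_eq_integral => //.
- apply: emeasurable_funM; first exact/measurable_EFinP.
  exact: (measurable_int _ irn).
- by apply: emeasurable_funM; [exact/measurable_EFinP|exact: mpdf].
- apply: ae_eqe_mul2l; apply: integral_ae_eq => //.
  by move=> A AT mA; rewrite -Radon_Nikodym_SigmaFinite.f_integral.
Qed.

Let pdfE x : pdf x = normal_peak s * expR (- x ^+ 2 / (s ^+ 2 *+ 2)).
Proof. by rewrite /pdf normal_pdfE ?gt_eqF// /normal_fun subr0. Qed.

Let pdf_ge0 x : 0 <= pdf x. Proof. exact: normal_pdf_ge0. Qed.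

Let mpdf : measurable_fun setT pdf. Proof. exact: measurable_normal_pdf. Qed.

Let cpdf : continuous pdf.
Proof. by apply: continuous_normal_pdf; rewrite gt_eqF. Qed.

Let is_derive_pdf x : is_derive x (1 : R) pdf (- (x / s ^+ 2) * pdf x).
Proof.
rewrite (_ : pdf = fun x => normal_peak s * expR (- x ^+ 2 / (s ^+ 2 *+ 2))); last first.
  by apply/funext => y; exact: pdfE.
apply: is_derive_eq.
rewrite /GRing.scale/= mulr0 add0r !mulr1.
by field; rewrite gt_eqF.
Qed.

Let is_derive_primitive k x :
  is_derive x (1 : R) (fun x => - s ^+ 2 * (x ^+ k.+1 * pdf x))
    (x ^+ k.+2 * pdf x - k.+1%:R * s ^+ 2 * (x ^+ k * pdf x)).
Proof.
have := is_derive_pdf x => dp.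
have -> : (fun x => - s ^+ 2 * (x ^+ k.+1 * pdf x)) =
    cst (- s ^+ 2) * ((id : R -> R) ^+ k.+1 * pdf).
  by apply/funext => y; rewrite !fctE; elim: k => // k IH; rewrite !exprS.
apply: is_derive_eq; rewrite /GRing.scale/= !fctE.
rewrite !(exprS x); set c := k.+1%:R; set u := x ^+ k; set v := pdf x.
by field; rewrite gt_eqF.
Qed.

(** For [y] of order [x^2] this is a decay of order [x^-4], enough for the boundary
    terms [x^(k + 1) pdf x] with [k <= 2]. *)
Lemma expRN_le_sqr (y : R) : 0 < y -> expR (- y) <= 4 / y ^+ 2.
Proof.
move=> y0; have y20 : 0 < y / 2 by rewrite divr_gt0.
have -> : 4 / y ^+ 2 = ((y / 2) ^+ 2)^-1 by field; rewrite gt_eqF.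
rewrite expRN lef_pV2 ?posrE ?expR_gt0 ?exprn_gt0//.
rewrite [X in expR X](_ : y = y / 2 + y / 2); last by field.
rewrite expRD -expr2 ler_sqr ?nnegrE ?expR_ge0 ?(ltW y20)//.
by apply: le_trans (expR_ge1Dx _); rewrite lerDr.
Qed.

Let pdf_tail x : 1 <= x -> x ^+ 3 * pdf x <= 16 * normal_peak s * s ^+ 4 / x.
Proof.
move=> x1; have x0 : 0 < x by exact: lt_le_trans x1.
have s20 : 0 < s ^+ 2 *+ 2 by rewrite pmulrn_lgt0// exprn_gt0.
have y0 : 0 < x ^+ 2 / (s ^+ 2 *+ 2) by rewrite divr_gt0 ?exprn_gt0.
rewrite pdfE mulNr; have h : expR (- (x ^+ 2 / (s ^+ 2 *+ 2))) <= 16 * s ^+ 4 / x ^+ 4.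
  apply: le_trans (expRN_le_sqr y0) _.
  rewrite le_eqVlt; apply/orP; left; apply/eqP; field.
  by rewrite !gt_eqF.
rewrite mulrCA; apply: le_trans.
  apply: ler_wpM2l; first exact: normal_peak_ge0.
  by apply: ler_wpM2l h; rewrite exprn_ge0// ltW.
rewrite le_eqVlt; apply/orP; left; apply/eqP; field.
by rewrite gt_eqF.
Qed.

Let cvg_primitive k : (k <= 2)%N ->
  - s ^+ 2 * (n%:R ^+ k.+1 * pdf n%:R) @[n --> \oo] --> (0 : R).
Proof.
move=> k2; rewrite -(mulr0 (- s ^+ 2)); apply: cvgMr.
apply: (@squeeze_cvgr _ _ _ _ (cst 0) (fun n => 16 * normal_peak s * s ^+ 4 / n%:R)).
- near=> n; have n1 : 1 <= n%:R :> R by rewrite ler1n; near: n; exact: nbhs_infty_ge.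
  apply/andP; split; first by rewrite mulr_ge0 ?exprn_ge0.
  apply: le_trans (pdf_tail n1); rewrite ler_wpM2r//.
  by rewrite ler_weXn2l.
- exact: cvg_cst.
- rewrite -[X in _ --> X](mulr0 (16 * normal_peak s * s ^+ 4)); apply: cvgMr.
  apply/gtr0_cvgV0; last exact: cvgr_idn.
  by near=> n; rewrite ltr0n; near: n; exact: nbhs_infty_gt.
Unshelve. all: by end_near. Qed.

Let cmono k : continuous (fun x : R => x ^+ k * pdf x).
Proof.
by move=> x; apply: cvgM; [exact: exprn_continuous|exact: cpdf].
Qed.

Let mmono k : measurable_fun setT (fun x : R => x ^+ k * pdf x).
Proof. exact: continuous_measurable_fun. Qed.

Let half k := (\int[mu]_(x in `[0%R, +oo[) (x ^+ k * pdf x)%:E)%E.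

(** Integration by parts on [[0, n]]; the boundary term at [n] tends to [0]. *)
Let half_rec k I : ~~ odd k -> (k <= 2)%N -> half k = I%:E ->
  half k.+2 = (k.+1%:R * s ^+ 2 * I)%:E.
Proof.
move=> ek k2 hk.
have ge0 j : ~~ odd j -> forall x, 0 <= x ^+ j * pdf x.
  by move=> ej x; rewrite mulr_ge0// exprn_even_ge0.
have ek2 : ~~ odd k.+2 by rewrite /= negbK.
have c1 := @ge0_cvgn_integral R mu _ (ge0 _ ek2) (mmono _).
have c0 := @ge0_cvgn_integral R mu _ (ge0 _ ek) (mmono _).
rewrite -/(half k) hk in c0.
have ci j n : mu.-integrable `[0, n%:R] (EFin \o (fun x : R => x ^+ j * pdf x)).
  apply: continuous_compact_integrable; first exact: segment_compact.
  exact/continuous_subspaceT/cmono.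
have key n : (0 < n)%N ->
  (\int[mu]_(x in `[0%R, n%:R]) (x ^+ k.+2 * pdf x)%:E =
   (- s ^+ 2 * (n%:R ^+ k.+1 * pdf n%:R))%:E + (k.+1%:R * s ^+ 2)%:E *
   \int[mu]_(x in `[0%R, n%:R]) (x ^+ k * pdf x)%:E)%E.
(* An antiderivative of the difference of the two integrands. *)
  move=> n0; pose F (x : R) := - s ^+ 2 * (x ^+ k.+1 * pdf x).
  have dF x : is_derive x (1 : R) F _ := is_derive_primitive k x.
  have cF x : F y @[y --> x] --> F x.
    by apply: differentiable_continuous; apply/derivable1_diffP.
  pose f x := x ^+ k.+2 * pdf x - k.+1%:R * s ^+ 2 * (x ^+ k * pdf x).
  have FTC : (\int[mu]_(x in `[0%R, n%:R]) (f x)%:E = (F n%:R)%:E - (F 0)%:E)%E.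
    apply: continuous_FTC2; first by rewrite ltr0n.
    - apply: continuous_subspaceT => x; apply: cvgB; first exact: cmono.
      by apply: cvgMr; exact: cmono.
    - split=> [x _||]; [exact: ex_derive|exact: cvg_at_right_filter|exact: cvg_at_left_filter].
    - by move=> x _; rewrite derive1E derive_val.
  have {}FTC : (\int[mu]_(x in `[0%R, n%:R]) (x ^+ k.+2 * pdf x)%:E -
      (k.+1%:R * s ^+ 2)%:E * \int[mu]_(x in `[0%R, n%:R]) (x ^+ k * pdf x)%:E =
      (F n%:R)%:E)%E.
    rewrite -integralZl//; last exact: ci.
    under [X in (_ - X)%E]eq_integral do rewrite -EFinM.
    have i1 : mu.-integrable `[0, n%:R]
        (EFin \o (fun x : R => k.+1%:R * s ^+ 2 * (x ^+ k * pdf x))).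
      apply: continuous_compact_integrable; first exact: segment_compact.
      by apply: continuous_subspaceT => x; apply: cvgMr; exact: cmono.
    rewrite -(integralB_EFin _ (ci k.+2 n) i1)//.
    under eq_integral do rewrite -EFinB.
    by rewrite FTC /F expr0n/= mul0r mulr0 sube0.
  have /integrable_fin_num := ci k n => /(_ (measurable_itv _)).
  rewrite /comp; set b := (\int[mu]_(x in _) (x ^+ k * _)%:E)%E => bf.
  by rewrite -/(F _) -FTC subeK// fin_numM.
have lim2 : (\int[mu]_(x in `[0%R, n%:R]) (x ^+ k.+2 * pdf x)%:E @[n --> \oo] -->
    (0%:E + (k.+1%:R * s ^+ 2)%:E * I%:E))%E.
  have L0 : ((- s ^+ 2 * (n%:R ^+ k.+1 * pdf n%:R))%:E @[n --> \oo] --> 0%:E)%E.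
    by apply: cvg_EFin; [exact: nearW|exact: cvg_primitive k2].
  have L1 : ((k.+1%:R * s ^+ 2)%:E *
      \int[mu]_(x in `[0%R, n%:R]) (x ^+ k * pdf x)%:E @[n --> \oo] -->
      (k.+1%:R * s ^+ 2)%:E * I%:E)%E by exact: cvgeZl.
  have L : (0%:E +? (k.+1%:R * s ^+ 2)%:E * I%:E)%E by rewrite fin_num_adde_defr.
  apply: cvg_trans (cvgeD L L0 L1).
  by apply: near_eq_cvg; near=> n; rewrite /= key//; near: n; exact: nbhs_infty_gt.
by rewrite /half (cvg_unique _ c1 lim2)// add0e.
Unshelve. all: by end_near.
Qed.

Let halfE k : ~~ odd k ->
  (\int[mu]_x (x ^+ k * pdf x)%:E = 2%:E * half k)%E.
Proof.
move=> ek; rewrite ge0_symfun_integralT; last 3 first.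
- by move=> x; rewrite mulr_ge0// exprn_even_ge0.
- exact: cmono.
- by move=> x /=; rewrite exprNn -signr_odd (negbTE ek) expr0 mul1r !pdfE sqrrN.
congr (_ * _)%E; congr (integral _ _ _).
by apply/seteqP; split => x /=; rewrite in_itv/= andbT.
Qed.

Let half0 : half 0 = (2^-1)%:E.
Proof.
have := @halfE 0 isT; under eq_integral do rewrite expr0 mul1r.
rewrite integral_normal_pdf => /(congr1 (fun x => (2^-1)%:E * x)%E).
by rewrite mule1 muleA -EFinM mulVf// mul1e => ->.
Qed.

Let half2 : half 2 = (s ^+ 2 / 2)%:E.
Proof. by rewrite (@half_rec 0 _ isT isT half0)// mul1r. Qed.

Let half4 : half 4 = (3 * s ^+ 4 / 2)%:E.
Proof. by rewrite (@half_rec 2 _ isT isT half2)//; congr EFin; field. Qed.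

Let normal_prob_moment k c : ~~ odd k -> half k = (c / 2)%:E ->
  (\int[normal_prob 0 s]_x (x ^+ k)%:E = c%:E)%E.
Proof.
move=> ek hk; rewrite ge0_integral_normal_prob.
- by rewrite halfE// hk -EFinM mulrCA mulfV ?mulr1.
- by move=> x; rewrite exprn_even_ge0.
- exact: exprn_measurable.
Qed.

Lemma normal_prob_moment2 : (\int[normal_prob 0 s]_x (x ^+ 2)%:E = (s ^+ 2)%:E)%E.
Proof. exact: normal_prob_moment half2. Qed.

Lemma normal_prob_moment4 :
  (\int[normal_prob 0 s]_x (x ^+ 4)%:E = (3 * s ^+ 4)%:E)%E.
Proof. exact: normal_prob_moment half4. Qed.

(** The positive and negative parts of the identity have equal integrals because
    [|x|] integrates to twice the integral of its restriction to the half line. *)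
Lemma normal_prob_sym : (\int[normal_prob 0 s]_x (Num.max x 0)%:E =
  \int[normal_prob 0 s]_x (Num.max (- x) 0)%:E)%E.
Proof.
have mp : measurable_fun setT (fun x : R => Num.max x 0) by exact: measurable_maxr.
have mn : measurable_fun setT (fun x : R => Num.max (- x) 0) by exact: measurable_maxr.
have mabs : measurable_fun setT (fun x : R => `|x|) by exact: normr_measurable.
have p0 x : 0 <= Num.max x 0 :> R by rewrite le_max lexx orbT.
set a := (LHS); set b := (RHS).
have abE : (a + b = \int[normal_prob 0 s]_x `|x|%:E)%E.
  rewrite /a /b -ge0_integralD//=.
  - apply: eq_integral => x _; rewrite -EFinD; congr EFin.
    by case: (leP x 0) => x0; [rewrite ler0_norm// max_l ?add0r ?oppr_ge0|
      rewrite gtr0_norm// max_r ?addr0 ?oppr_le0// ltW].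
  - by move=> x _; rewrite lee_fin.
  - exact/measurable_EFinP.
  - by move=> x _; rewrite lee_fin.
  - exact/measurable_EFinP.
have a2 : (\int[normal_prob 0 s]_x `|x|%:E = 2%:E * a)%E.
  rewrite /a !ge0_integral_normal_prob//= ge0_symfun_integralT; last 3 first.
  - by move=> x; rewrite mulr_ge0// normal_pdf_ge0.
  - by move=> x; apply: cvgM; [exact: norm_continuous|exact: cpdf].
  - by move=> x /=; rewrite normrN -!/(pdf _) !pdfE sqrrN.
  congr (_ * _)%E; rewrite integral_mkcond; apply: eq_integral => x _.
  rewrite patchE; case: ifPn => [|]; rewrite ?inE ?notin_setE /= => x0.
    by rewrite ger0_norm// max_l.
  by rewrite max_r ?mul0r// leNgt; apply/negP => /ltW.
have afin : a \is a fin_num.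
  rewrite ge0_fin_numE; last by apply: integral_ge0 => x _; rewrite lee_fin.
  apply: (@le_lt_trans _ _ (\int[normal_prob 0 s]_x (1 + x ^+ 2)%:E)%E).
    apply: ge0_le_integral => //=.
    - by move=> x _; rewrite lee_fin.
    - exact/measurable_EFinP.
    - by apply/measurable_EFinP/measurable_funD => //; exact: exprn_measurable.
    move=> x _; rewrite lee_fin ge_max addr_ge0 ?sqr_ge0// andbT.
    by have := sqr_ge0 (x - 1); nra.
  under eq_integral do rewrite EFinD.
  rewrite ge0_integralD//=.
  - by rewrite normal_prob_moment2 integral_cst//= probability_setT mule1 -EFinD ltry.
  - by move=> x _; rewrite lee_fin sqr_ge0.
  - by apply/measurable_EFinP; exact: exprn_measurable.
have := congr1 (fun x => x - a)%E abE.
by rewrite a2 mule_natl mule2n addeAC subee// add0e addeK.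
Qed.
End NormalMoments.

Section NormalLaw.
Variables (R : realType) (d : measure_display) (T : measurableType d).
Variable P : probability T R.

Lemma ge0_integral_normal_law (X : {RV P >-> R}) (v : R) (f : R -> R) :
  has_normal_law P X 0 v -> measurable_fun setT f -> (forall x, 0 <= f x) ->
  (\int[P]_w (f (X w))%:E = if v == 0%R then (f 0%R)%:E
    else \int[normal_prob 0%R (Num.sqrt v)]_x (f x)%:E)%E.
Proof.
move=> hX mf f0.
have mEf : measurable_fun setT (EFin \o f) by exact/measurable_EFinP.
(* The law of X is viewed on the copy of R that carries normal_prob. *)
have mX : measurable_fun setT (X : T -> measurableTypeR R).
  by move=> _ A mA; exact: (@measurable_funPT _ _ _ _ X).
have -> : (\int[P]_w (f (X w))%:E =
    \int[pushforward P (X : T -> measurableTypeR R)]_y (f y)%:E)%E.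
  by rewrite (@ge0_integral_pushforward _ _ _ _ _ _ mX)// => y _; rewrite lee_fin f0.
case: ifPn => v0.
  transitivity (\int[\d_(0%R : measurableTypeR R)]_y (f y)%:E)%E.
    apply: eq_measure_integral => A mA _.
    by have := hX A mA; rewrite /normal_law v0; exact.
  by rewrite integral_dirac// diracT mul1e.
apply: eq_measure_integral => A mA _.
by have := hX A mA; rewrite /normal_law (negbTE v0); exact.
Qed.

Lemma normal_law_moments (X : {RV P >-> R}) (v : R) :
  0 <= v -> has_normal_law P X 0 v ->
  [/\ (\int[P]_w (X w ^+ 2)%:E = v%:E)%E,
      (\int[P]_w (X w ^+ 4)%:E = (3 * v ^+ 2)%:E)%E &
      (\int[P]_w (Num.max (X w) 0)%:E = \int[P]_w (Num.max (- X w) 0)%:E)%E].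
Proof.
move=> v0 hX.
have intE f mf f0 := @ge0_integral_normal_law X v f hX mf f0.
rewrite (intE (fun x => x ^+ 2)); [|exact: exprn_measurable|by move=> x; exact: sqr_ge0].
rewrite (intE (fun x => x ^+ 4)); [|exact: exprn_measurable|by move=> x; exact: exprn_even_ge0].
rewrite (intE (fun x => Num.max x 0)); 
  [|exact: measurable_maxr|by move=> x; rewrite le_max lexx orbT].
rewrite (intE (fun x => Num.max (- x) 0));
  [|exact: measurable_maxr|by move=> x; rewrite le_max lexx orbT].
case: eqVneq => [->|vn0]; first by rewrite !expr0n/= mulr0 oppr0.
have sv : 0 < Num.sqrt v by rewrite sqrtr_gt0 lt_neqAle eq_sym vn0.
split; [|rewrite normal_prob_moment4//|exact: normal_prob_sym].
  by rewrite normal_prob_moment2// sqr_sqrtr.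
by rewrite (_ : 4 = 2 * 2)%N// exprM sqr_sqrtr.
Qed.
End NormalLaw.

(** * Finite moments and independence of pairs *)

Section Expectation.
Context {R : realType} {d : measure_display} {T : measurableType d}.
Variable P : probability T R.
Implicit Types X Y Z : T -> R.

Definition itg X := P.-integrable setT (EFin \o X).
Definition Ex X : R := \int[P]_w X w.
(** Membership in [L^k], used for [k = 1] and for even [k], where it amounts to a
    finite absolute moment. *)
Definition mom k X := measurable_fun setT X /\ itg (fun w => X w ^+ k).

Lemma itg_le X Y : measurable_fun setT X -> itg Y ->
  (forall w, `|X w| <= Y w) -> itg X.
Proof.
move=> mX iY XY; apply: (le_integrable measurableT _ _ iY).
  exact/measurable_EFinP.
by move=> w _ /=; rewrite lee_fin (le_trans (XY w))// ler_norm.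
Qed.

Lemma itg_cst (c : R) : itg (fun=> c).
Proof. exact: finite_measure_integrable_cst. Qed.

Lemma itgD X Y : itg X -> itg Y -> itg (fun w => X w + Y w).
Proof. by move=> iX iY; exact: (integrableD measurableT iX iY). Qed.

Lemma itgZ (c : R) X : itg X -> itg (fun w => c * X w).
Proof. by move=> iX; exact: (integrableZl measurableT c iX). Qed.

Lemma itg_sum (I : Type) (s : seq I) (X : I -> T -> R) :
  (forall i, itg (X i)) -> itg (fun w => \sum_(i <- s) X i w).
Proof.
move=> iX; elim: s => [|i s IH].
  by under eq_fun do rewrite big_nil; exact: itg_cst.
by under eq_fun do rewrite big_cons; exact: itgD.
Qed.

Lemma ExD X Y : itg X -> itg Y -> Ex (fun w => X w + Y w) = Ex X + Ex Y.
Proof. by move=> iX iY; exact: RintegralD. Qed.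

Lemma ExZ (c : R) X : itg X -> Ex (fun w => c * X w) = c * Ex X.
Proof. by move=> iX; exact: RintegralZl. Qed.

Lemma Ex_cst (c : R) : Ex (fun=> c) = c.
Proof.
rewrite /Ex Rintegral_cst// -[RHS]mulr1.
exact: (congr1 (fun x => c * fine x) (probability_setT P)).
Qed.

Lemma Ex_sum (I : Type) (s : seq I) (X : I -> T -> R) :
  (forall i, itg (X i)) ->
  Ex (fun w => \sum_(i <- s) X i w) = \sum_(i <- s) Ex (X i).
Proof.
move=> iX; elim: s => [|i s IH].
  by under eq_fun do rewrite big_nil; rewrite Ex_cst big_nil.
under eq_fun do rewrite big_cons; rewrite big_cons ExD ?IH//.
exact: itg_sum.
Qed.

Lemma Ex_ge0 X : (forall w, 0 <= X w) -> 0 <= Ex X.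
Proof. by move=> X0; exact: Rintegral_ge0. Qed.

Lemma Ex_le X Y : itg X -> itg Y -> (forall w, X w <= Y w) -> Ex X <= Ex Y.
Proof. by move=> iX iY XY; exact: le_Rintegral. Qed.

Lemma mom1P X : mom 1 X -> itg X.
Proof. by case. Qed.

Lemma mom_cst k (c : R) : mom k (fun=> c).
Proof. by split; [exact: measurable_cst|exact: itg_cst]. Qed.

Lemma momZ k (c : R) X : mom k X -> mom k (fun w => c * X w).
Proof.
move=> [mX iX]; split; first exact: measurable_funM.
by under eq_fun do rewrite exprMn; exact: itgZ.
Qed.

Lemma sqr_add_le (x y : R) : (x + y) ^+ 2 <= 2 * (x ^+ 2 + y ^+ 2).
Proof. by have := sqr_ge0 (x - y); nra. Qed.

Lemma mom2D X Y : mom 2 X -> mom 2 Y -> mom 2 (fun w => X w + Y w).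
Proof.
move=> [mX iX] [mY iY]; split; first exact: measurable_funD.
apply: itg_le (itgZ 2 (itgD iX iY)) _; first exact/measurable_funX/measurable_funD.
by move=> w; rewrite ger0_norm ?sqr_ge0// sqr_add_le.
Qed.

Lemma expr4 (x : R) : x ^+ 4 = (x ^+ 2) ^+ 2.
Proof. by rewrite -exprM. Qed.

Lemma mom4D X Y : mom 4 X -> mom 4 Y -> mom 4 (fun w => X w + Y w).
Proof.
move=> [mX iX] [mY iY]; split; first exact: measurable_funD.
apply: itg_le (itgZ 8 (itgD iX iY)) _; first exact/measurable_funX/measurable_funD.
move=> w; rewrite ger0_norm ?exprn_even_ge0// !expr4.
apply: (@le_trans _ _ ((2 * (X w ^+ 2 + Y w ^+ 2)) ^+ 2)).
  by rewrite ler_sqr ?nnegrE ?sqr_ge0 ?sqr_add_le// mulr_ge0// addr_ge0 ?sqr_ge0.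
by have := sqr_add_le (X w ^+ 2) (Y w ^+ 2); nra.
Qed.

Lemma mom42 X : mom 4 X -> mom 2 X.
Proof.
move=> [mX iX]; split=> //; apply: itg_le (itgD (itg_cst 1) iX) _.
  exact: measurable_funX.
move=> w; rewrite ger0_norm ?sqr_ge0// !expr4.
by have := sqr_ge0 (X w ^+ 2 - 1); have := sqr_ge0 (X w); nra.
Qed.

Lemma mom21 X : mom 2 X -> mom 1 X.
Proof.
move=> [mX iX]; split=> //; apply: itg_le (itgD (itg_cst 1) iX) _ => //.
move=> w; rewrite expr1 -(real_normK (num_real (X w))).
by have := sqr_ge0 (`|X w| - 1); have := sqr_ge0 (`|X w|); nra.
Qed.

Lemma mom2M X Y : mom 4 X -> mom 4 Y -> mom 2 (fun w => X w * Y w).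
Proof.
move=> [mX iX] [mY iY]; split; first exact: measurable_funM.
apply: itg_le (itgD iX iY) _; first exact/measurable_funX/measurable_funM.
move=> w; rewrite ger0_norm ?sqr_ge0// exprMn !expr4.
by have := sqr_ge0 (X w ^+ 2 - Y w ^+ 2); have := sqr_ge0 (X w ^+ 2 + Y w ^+ 2); nra.
Qed.

Lemma mom1M X Y : mom 2 X -> mom 2 Y -> mom 1 (fun w => X w * Y w).
Proof.
move=> [mX iX] [mY iY]; split; first exact: measurable_funM.
apply: itg_le (itgD iX iY) _; first exact: measurable_funM.
move=> w; rewrite expr1 ler_norml.
by have := sqr_ge0 (X w - Y w); have := sqr_ge0 (X w + Y w);
  have := sqr_ge0 (X w); have := sqr_ge0 (Y w); move=> *; apply/andP; split; nra.
Qed.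

Lemma itgM X Y : mom 2 X -> mom 2 Y -> itg (fun w => X w * Y w).
Proof. by move=> mX mY; exact/mom1P/mom1M. Qed.

Lemma mom_sum k (I : Type) (s : seq I) (X : I -> T -> R) :
  (forall Y Z, mom k Y -> mom k Z -> mom k (fun w => Y w + Z w)) ->
  (forall i, mom k (X i)) -> mom k (fun w => \sum_(i <- s) X i w).
Proof.
move=> kD iX; elim: s => [|i s IH].
  by under eq_fun do rewrite big_nil; exact: mom_cst.
by under eq_fun do rewrite big_cons; exact: kD.
Qed.

Definition indep2 X Y := forall A B : set R, measurable A -> measurable B ->
  P (X @^-1` A `&` Y @^-1` B) = (P (X @^-1` A) * P (Y @^-1` B))%E.

Lemma indep2_comp X Y (f g : R -> R) : measurable_fun setT f ->
  measurable_fun setT g -> indep2 X Y -> indep2 (f \o X) (g \o Y).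
Proof.
move=> mf mg XY A B mA mB; apply: (XY (f @^-1` A) (g @^-1` B)).
  by rewrite -[X in measurable X]setTI; exact: mf.
by rewrite -[X in measurable X]setTI; exact: mg.
Qed.

(** Fubini on the product of the two laws, which is the joint law. *)
Lemma Ex_mul_indep X Y : measurable_fun setT X -> measurable_fun setT Y ->
  indep2 X Y -> itg X -> itg Y -> itg (fun w => X w * Y w) ->
  Ex (fun w => X w * Y w) = Ex X * Ex Y.
Proof.
move=> mX mY XY iX iY iXY.
pose X' : {RV P >-> R} := HB.pack X (isMeasurableFun.Build _ _ _ _ _ mX).
pose Y' : {RV P >-> R} := HB.pack Y (isMeasurableFun.Build _ _ _ _ _ mY).
have mXY : measurable_fun setT (fun w => (X w, Y w)) by exact: measurable_fun_pair.
pose Z' : {RV P >-> (R * R)%type} := HB.pack (fun w => (X w, Y w))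
  (isMeasurableFun.Build _ _ _ _ _ mXY).
pose PX : probability R R := distribution P X'.
pose PY : probability R R := distribution P Y'.
pose PZ : probability (R * R)%type R := distribution P Z'.
have prodE A : measurable A -> (PX \x PY)%E A = PZ A.
  by move=> mA; apply: product_measure_unique => // A1 A2 mA1 mA2; exact: XY.
pose f (z : R * R) := (z.1 * z.2)%:E.
have mf : measurable_fun setT f.
  apply/measurable_EFinP/measurable_funM; exact: measurable_fst || exact: measurable_snd.
have ZE (g : R * R -> \bar R) :
    (\int[PX \x PY]_z g z = \int[PZ]_z g z)%E.
  by apply: eq_measure_integral => A mA _; exact: prodE.
have intf : (PX \x PY)%E.-integrable setT f.
  apply/integrableP; split=> //; rewrite ZE ge0_integral_distribution//; last first.
    exact: measurableT_comp.
  by move/integrableP : iXY => [].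
have law_mean (Z : {RV P >-> R}) : itg Z ->
    (\int[distribution P Z]_y y%:E = (Ex Z)%:E)%E.
  move=> iZ; rewrite (@integral_distribution _ _ _ _ _ P Z EFin)//.
  by rewrite /Ex /Rintegral fineK//; exact: integrable_fin_num.
have intPX : (\int[PX]_y y%:E = (Ex X)%:E)%E := law_mean X' iX.
have intPY : (\int[PY]_y y%:E = (Ex Y)%:E)%E := law_mean Y' iY.
have iid (Z : {RV P >-> R}) : itg Z ->
    (distribution P Z : probability R R).-integrable setT EFin.
  move=> /integrableP[_ iZ]; apply/integrableP; split=> //.
  by rewrite ge0_integral_distribution//; exact: measurableT_comp.
have : (\int[PX]_x (\int[PY]_y f (x, y)) = (Ex (fun w => X w * Y w))%:E)%E.
  rewrite (integral12_prod_meas1 intf) ZE.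
  rewrite (@integral_distribution _ _ _ _ _ P Z' f)//.
  by rewrite /Ex /Rintegral fineK//; exact: integrable_fin_num.
have inner x : (\int[PY]_y f (x, y) = (x * Ex Y)%:E)%E.
  under eq_integral do rewrite /f EFinM.
  by rewrite integralZl ?intPY//; exact: (iid Y').
under eq_integral do rewrite inner EFinM.
by rewrite integralZr ?intPX//; [move=> [<-]|exact: (iid X')].
Qed.
End Expectation.

(** * Independence of blocks *)

Section Grouping.
Context {R : realType} {d : measure_display} {T : measurableType d}.
Variable P : probability T R.

(** The finite intersections of events of the blocks in [J] form a pi-system on
    which the finite measures [P (_ `&` B)] and [P B * P _] agree. *)
Lemma independent_join (I : finType) (H : I -> set (set T)) (J : {set I}) i0 :
  (forall i, H i `<=` measurable) ->
  mutually_independent P (fun i => <<s H i >>) -> i0 \notin J ->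
  independent P <<s \bigcup_(i in [set i | i \in J]) <<s H i >> >> <<s H i0 >>.
Proof.
move=> Hm indep i0J A B sA FB.
have Fm i : <<s H i >> `<=` measurable.
  by apply: smallest_sub; [exact: sigma_algebra_measurable|exact: Hm].
have FI i : setI_closed <<s H i >>.
  move=> C D; exact: (@measurableI _ (g_sigma_algebraType (H i))).
have FT i : <<s H i >> setT by exact: (@measurableT _ (g_sigma_algebraType (H i))).
pose G := [set C | exists2 E : I -> set T, (forall i, <<s H i >> (E i)) &
  C = \bigcap_(i in [set i | i \in J]) E i].
have Gm : G `<=` measurable.
  move=> _ [E FE ->]; apply: fin_bigcap_measurable.
    exact: finite_finset.
  by move=> i _; exact: Fm.
have GI : setI_closed G.
  move=> _ _ [E FE ->] [E' FE' ->]; exists (fun i => E i `&` E' i).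
    by move=> i; exact: FI.
  by rewrite -bigcapI.
have mB := Fm _ _ FB.
pose m2 := mscale (NngNum (fine_ge0 (measure_ge0 P B))) P.
pose m1 := mrestr P mB.
have m12 C : G C -> m1 C = m2 C.
  move=> [E FE CE]; rewrite /m1 /m2 /mrestr /mscale /=.
  rewrite fineK ?fin_num_measure//.
  pose E' i := if i == i0 then B else E i.
  have E'J i : i \in J -> E' i = E i.
    by rewrite /E'; case: eqP => // ->; rewrite (negbTE i0J).
  have FE' i : <<s H i >> (E' i) by rewrite /E'; case: eqP => // ->.
  have := indep (i0 |: J) E' (fun i _ => FE' i).
  have E'0 : E' i0 = B by rewrite /E' eqxx.
  rewrite big_setU1//= E'0; under eq_bigr => i iJ do rewrite E'J//.
  have <- := indep J E (fun i _ => FE i); rewrite -CE => <-.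
  congr (P _); rewrite setIC CE; apply/seteqP; split=> [w [Bw Ew] i|w Ew].
    rewrite /= !inE => /predU1P[->|iJ]; first by rewrite E'0.
    by rewrite E'J//; exact: Ew.
  split; first by rewrite -E'0; apply: Ew; rewrite /= !inE eqxx.
  by move=> i /= iJ; rewrite -(E'J i iJ); apply: Ew; rewrite /= !inE iJ orbT.
have sub : \bigcup_(i in [set i | i \in J]) <<s H i >> `<=` G.
  move=> C [i /= iJ FC]; exists (fun j => if j == i then C else setT).
    by move=> j; case: eqP => // ->.
  apply/seteqP; split=> [w Cw j _|w h]; first by case: eqP.
  by have := h i iJ; rewrite eqxx.
have GT : G setT by exists (fun=> setT) => //; rewrite bigcapT.
have cov : \bigcup_(k : nat) [set: T] = setT by rewrite bigcup_const.
have fin (k : nat) : (m1 setT < +oo)%E.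
  rewrite /m1 /mrestr setTI (le_lt_trans (probability_le1 _ _)) ?ltry//.
have m12A : m1 A = m2 A := @g_sigma_algebra_measure_unique _ R T G Gm (fun=> setT)
  (fun=> GT) cov m1 m2 GI m12 fin A (sub_sigma_algebra2 sub sA).
move: m12A; rewrite /m1 /m2 /mrestr /mscale /=.
by rewrite fineK ?fin_num_measure// => ->; rewrite muleC.
Qed.
End Grouping.

(** * Linear forms of independent Gaussian families *)

Section Gauss4.
Context {R : realType} {d : measure_display} {T : measurableType d}.
Variable P : probability T R.
Implicit Types X Y : T -> R.

(** The part of normality that is needed: a centred variable whose moments of
    order two and four are those of a normal law. Unlike normality, its stability under
    independent sums is a mere expansion ([gauss4D]). *)
Definition gauss4 X (v : R) := [/\ mom P 4 X, Ex P X = 0,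
  Ex P (fun w => X w ^+ 2) = v & Ex P (fun w => X w ^+ 4) = 3 * v ^+ 2].

Lemma gauss4_normal X v : measurable_fun setT X -> 0 <= v ->
  has_normal_law P X 0 v -> gauss4 X v.
Proof.
move=> mX v0 hX.
pose X' : {RV P >-> R} := HB.pack X (isMeasurableFun.Build _ _ _ _ _ mX).
have [m2 m4 ms] := @normal_law_moments R d T P X' v v0 hX.
have m4X : mom P 4 X.
  split=> //; apply/integrableP; split.
    exact/measurable_EFinP/measurable_funX.
  under eq_integral do rewrite /= ger0_norm ?exprn_even_ge0//.
  by rewrite m4 ltry.
split=> //; last 2 first.
- by rewrite /Ex /Rintegral m2.
- by rewrite /Ex /Rintegral m4.
have iX := mom1P (mom21 (mom42 m4X)).
have mmax Y : measurable_fun setT Y -> measurable_fun setT (fun w => Num.max (Y w) 0).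
  by move=> mY; exact: measurable_maxr.
have imax Y : itg P Y -> itg P (fun w => Num.max (Y w) 0).
  move=> iY; apply: itg_le (integrable_norm iY) _.
    by apply: mmax; apply/measurable_EFinP; exact: (measurable_int _ iY).
  by move=> w /=; case: (leP (Y w) 0) => h; rewrite ?normr0//.
have iN : itg P (fun w => - X w).
  by under eq_fun do rewrite -mulN1r; exact: itgZ.
have -> : Ex P X = Ex P (fun w => Num.max (X w) 0 + -1 * Num.max (- X w) 0).
  congr Ex; apply/funext => w.
  by case: (leP (X w) 0) => h; [rewrite max_l ?oppr_ge0//|
    rewrite max_r ?oppr_le0 1?ltW//]; ring.
rewrite ExD ?ExZ; [|exact: imax|exact: imax|exact/itgZ/imax].
by rewrite mulN1r /Ex /Rintegral ms subrr.
Qed.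

Lemma gauss4Z c X v : gauss4 X v -> gauss4 (fun w => c * X w) (c ^+ 2 * v).
Proof.
move=> [m4 E1 E2 E4]; have m2 := mom42 m4; have [_ i4] := m4; have [_ i2] := m2.
split; first exact: momZ.
- by rewrite ExZ ?E1 ?mulr0//; exact/mom1P/mom21.
- by under eq_fun do rewrite exprMn; rewrite ExZ ?E2.
- by under eq_fun do rewrite exprMn; rewrite ExZ ?E4//; ring.
Qed.

(** In the expansions of [(X + Y)^2] and [(X + Y)^4] the terms with an odd power
    vanish, since one of their factors is centred. *)
Lemma gauss4D X Y v u : gauss4 X v -> gauss4 Y u -> indep2 P X Y ->
  gauss4 (fun w => X w + Y w) (v + u).
Proof.
move=> [m4X X1 X2 X4] [m4Y Y1 Y2 Y4] XY.
have m2X := mom42 m4X; have m2Y := mom42 m4Y.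
have [mX i4X] := m4X; have [mY i4Y] := m4Y.
have [_ i2X] := m2X; have [_ i2Y] := m2Y.
have i1X := mom1P (mom21 m2X); have i1Y := mom1P (mom21 m2Y).
have sq Z : mom P 4 Z -> mom P 2 (fun w => Z w ^+ 2).
  by move=> mZ; under eq_fun do rewrite expr2; exact: mom2M.
have EM (f g : R -> R) : measurable_fun setT f -> measurable_fun setT g ->
    itg P (f \o X) -> itg P (g \o Y) -> itg P (fun w => f (X w) * g (Y w)) ->
    Ex P (fun w => f (X w) * g (Y w)) = Ex P (f \o X) * Ex P (g \o Y).
  move=> mf mg if_ ig ifg; apply: Ex_mul_indep => //; try exact: measurableT_comp.
  exact: indep2_comp.
have mexp k : measurable_fun setT (fun x : R => x ^+ k) by exact: exprn_measurable.
have iXY : itg P (fun w => X w * Y w) by exact: itgM.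
have E11 : Ex P (fun w => X w * Y w) = 0.
  by rewrite (EM id id)//= X1 mul0r.
have i22 : itg P (fun w => X w ^+ 2 * Y w ^+ 2) by apply: itgM; exact: sq.
have E22 : Ex P (fun w => X w ^+ 2 * Y w ^+ 2) = v * u.
  by rewrite (EM (fun x => x ^+ 2) (fun x => x ^+ 2))// -X2 -Y2.
have i31 : itg P (fun w => X w ^+ 3 * Y w).
  by under eq_fun do rewrite exprSr -mulrA; apply: itgM; [exact: sq|exact: mom2M].
have i13 : itg P (fun w => X w * Y w ^+ 3).
  by under eq_fun do rewrite exprS mulrA; apply: itgM; [exact: mom2M|exact: sq].
have i3 Z : mom P 4 Z -> itg P (fun w => Z w ^+ 3).
  move=> m4Z; under eq_fun do rewrite exprSr.
  by apply: itgM; [exact: sq|exact: mom42].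
have E31 : Ex P (fun w => X w ^+ 3 * Y w) = 0.
  by rewrite (EM (fun x => x ^+ 3) id)//=; [rewrite Y1 mulr0|exact: i3].
have E13 : Ex P (fun w => X w * Y w ^+ 3) = 0.
  by rewrite (EM id (fun x => x ^+ 3))//=; [rewrite X1 mul0r|exact: i3].
split; first exact: mom4D.
- by rewrite ExD// X1 Y1 addr0.
- have -> : (fun w => (X w + Y w) ^+ 2) =
      (fun w => (X w ^+ 2 + Y w ^+ 2) + 2 * (X w * Y w)).
    by apply/funext => w; ring.
  rewrite ExD; [|exact: itgD|exact: itgZ].
  by rewrite ExD// ExZ// X2 Y2 E11 mulr0 addr0.
- have -> : (fun w => (X w + Y w) ^+ 4) = (fun w => (X w ^+ 4 + Y w ^+ 4) +
      (6 * (X w ^+ 2 * Y w ^+ 2) + 4 * (X w ^+ 3 * Y w + X w * Y w ^+ 3))).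
    by apply/funext => w; ring.
  have i3113 := itgD i31 i13.
  rewrite ExD; [|exact: itgD|by apply: itgD; exact: itgZ].
  rewrite ExD// ExD; [|exact: itgZ|exact: itgZ].
  by rewrite !ExZ// ExD// E22 E31 E13 X4 Y4; ring.
Qed.
End Gauss4.

Lemma bigsetU_ordP (U : Type) m (F : 'I_m -> set U) A :
  (\big[setU/set0]_(j < m) F j) A <-> exists j, F j A.
Proof.
split=> [|[j Fj]]; last by rewrite (bigD1 j)//=; left.
by elim/big_ind: _ => // [S S' IH IH' [/IH|/IH']//|j _ Fj]; exists j.
Qed.

Section LinearForms.
Context {R : realType} {d : measure_display} {T : measurableType d}.
Variable P : probability T R.
Variables (p n : nat) (b : 'I_p -> {RV P >-> R}) (eps : 'I_n -> {RV P >-> R}).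
Variables (B : 'M[R]_p) (sigma2 : R).
Hypotheses (sigma20 : 0 <= sigma2) (bB : gaussian_vector b B).
Hypothesis epsN : forall i, has_normal_law P (eps i) 0 sigma2.
Hypothesis indep : mutually_independent P (effects_errors b eps).

Let H (k : option 'I_n) : set (set T) :=
  if k is Some i
  then \big[setU/set0]_(j < 1) preimage_set_system setT (eps i : T -> R) measurable
  else \big[setU/set0]_(j < p) preimage_set_system setT (b j : T -> R) measurable.

Let HE : (fun k => <<s H k >>) = effects_errors b eps.
Proof. by apply/funext; case. Qed.

Let Hm k : H k `<=` measurable.
Proof.
by case: k => [i|] A /= /bigsetU_ordP[j [C mC <-]]; rewrite setTI;
  exact: measurable_funPTI.
Qed.

Let lin_dot (u : 'cV[R]_p) w : (u^T *m rvec b w) 0 0 = \sum_j u j 0 * b j w.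
Proof. by rewrite mxE; apply: eq_bigr => j _; rewrite !mxE. Qed.

Let S (u : 'cV[R]_p) (v : 'cV[R]_n) k w : R :=
  \sum_j u j 0 * b j w + \sum_(i < n | (i < k)%N) v i 0 * eps i w.

(** The errors are added one at a time to the linear form in [b]; at each step the
    next error is independent of the block formed by [b] and the previous errors. *)
Let S_gauss4 u v k : (k <= n)%N -> gauss4 P (S u v k)
  (qform B u + \sum_(i < n | (i < k)%N) v i 0 ^+ 2 * sigma2).
Proof.
elim: k => [_|k IH kn].
  rewrite [X in _ + X]big_pred0// addr0; apply: gauss4_normal; last 1 first.
  - suff -> : S u v 0 = (fun w => (u^T *m rvec b w) 0 0) by case: bB.
    by apply/funext => w; rewrite /S lin_dot [X in _ + X]big_pred0// addr0.
  - apply: measurable_funD; last by under eq_fun do rewrite big_pred0//; exact: measurable_cst.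
    by apply: measurable_sum => j; apply: measurable_funM.
  - by case: bB => -[].
have sumS (F : 'I_n -> R) : \sum_(i < n | (i < k.+1)%N) F i =
    \sum_(i < n | (i < k)%N) F i + F (Ordinal kn).
  rewrite (bigD1 (Ordinal kn))//= addrC; congr (_ + _).
  by apply: eq_bigl => i; rewrite ltnS ltn_neqAle -val_eqE /= andbC.
have -> : S u v k.+1 = (fun w => S u v k w + v (Ordinal kn) 0 * eps (Ordinal kn) w).
  by apply/funext => w; rewrite /S sumS addrA.
rewrite sumS addrA; apply: gauss4D; first exact/IH/ltnW.
  apply: gauss4Z; apply: gauss4_normal => //; exact: measurable_funP.
move=> A C mA mC.
pose J : {set option 'I_n} := [set k' : option 'I_n |
  if k' is Some i then (i < k)%N else true]%SET.
apply: (@independent_join _ _ _ P _ H J (Some (Ordinal kn))) => //.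
- by rewrite HE.
- by rewrite inE /= ltnn.
- pose G := \bigcup_(i in [set i | i \in J]) <<s H i >>.
  have sub (X : T -> R) i : i \in J -> (forall D, measurable D -> H i (X @^-1` D)) ->
      measurable_fun setT (X : g_sigma_algebraType G -> R).
    move=> iJ HX _ D mD; rewrite setTI; apply: sub_sigma_algebra.
    by exists i => //; apply: sub_sigma_algebra; exact: HX.
  suff mS : measurable_fun setT (S u v k : g_sigma_algebraType G -> R).
    by have := mS measurableT A mA; rewrite setTI.
  apply: measurable_funD.
    apply: measurable_sum => j; apply: measurable_funM => //.
    apply: (sub _ None); first by rewrite inE.
    by move=> D mD; apply/bigsetU_ordP; exists j; exists D => //; rewrite setTI.
  under eq_fun do rewrite big_mkcond/=.
  apply: measurable_sum => i; case: (boolP (i < k)%N) => ik; last exact: measurable_cst.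
  apply: measurable_funM => //.
  apply: (sub _ (Some i)); first by rewrite inE.
  by move=> D mD; apply/bigsetU_ordP; exists ord0; exists D => //; rewrite setTI.
- apply: sub_sigma_algebra; apply/bigsetU_ordP; exists ord0.
  exists ((fun x => v (Ordinal kn) 0 * x) @^-1` C); last by rewrite setTI.
  by rewrite -[X in measurable X]setTI; apply: measurable_funM.
Qed.

(** All random quantities below are quadratic in the single vector [(b, eps)], whose
    covariance is block diagonal. *)
Lemma gauss4_linear_form (u : 'cV[R]_(p + n)) :
  gauss4 P (fun w => dot u (col_mx (rvec b w) (rvec eps w)))
    (qform (block_mx B 0 0 (sigma2%:M)) u).
Proof.
have := @S_gauss4 (usubmx u) (dsubmx u) n (leqnn n).
have -> : S (usubmx u) (dsubmx u) n = (fun w => dot u (col_mx (rvec b w) (rvec eps w))).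
  apply/funext => w; rewrite /S dotE big_split_ord /=; congr (_ + _).
    by apply: eq_bigr => j _; rewrite col_mxEu !mxE.
  by apply: eq_big => i; rewrite ?ltn_ord// col_mxEd !mxE.
suff -> : qform (block_mx B 0 0 (sigma2%:M)) u = qform B (usubmx u) +
    \sum_(i < n | (i < n)%N) dsubmx u i 0 ^+ 2 * sigma2 by [].
rewrite -{1}[u]vsubmxK qformE mul_block_col !mul0mx addr0 add0r.
rewrite /dot tr_col_mx mul_row_col mxE -!/(dot _ _) -!qformE; congr (_ + _).
rewrite qformE mul_scalar_mx dotZr dotE mulr_sumr.
by apply: eq_big => i; rewrite ?ltn_ord// => _; rewrite -expr2 mulrC.
Qed.
End LinearForms.

(** * Moments of bilinear forms *)

Section Wick.
Context {R : realType} {d : measure_display} {T : measurableType d}.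
Variable P : probability T R.
Variables (k : nat) (x : T -> 'cV[R]_k) (C : 'M[R]_k).
Hypothesis sC : C^T = C.
Hypothesis xC : forall u, gauss4 P (fun w => dot u (x w)) (qform C u).
Let L u w : R := dot u (x w).
Let c u v : R := dot u (C *m v).

Let cC u v : c u v = c v u. Proof. by rewrite /c dot_mulr sC dotC. Qed.
Let LD u v w : L (u + v) w = L u w + L v w. Proof. exact: dotDl. Qed.
Let LB u v w : L (u - v) w = L u w - L v w. Proof. by rewrite LD /L dotNl. Qed.
Let cDl u v z : c (u + v) z = c u z + c v z. Proof. exact: dotDl. Qed.
Let cDr u v z : c z (u + v) = c z u + c z v. Proof. by rewrite cC cDl !(cC z). Qed.
Let cNl u z : c (- u) z = - c u z. Proof. exact: dotNl. Qed.
Let cNr u z : c z (- u) = - c z u. Proof. by rewrite cC cNl cC. Qed.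
Let m4 u : mom P 4 (L u). Proof. by case: (xC u). Qed.
Let m2 u : mom P 2 (L u). Proof. exact: mom42. Qed.
Let i4 u : itg P (fun w => L u w ^+ 4). Proof. by case: (m4 u). Qed.
Let i2 u : itg P (fun w => L u w ^+ 2). Proof. by case: (m2 u). Qed.
Let m22 u v : mom P 2 (fun w => L u w * L v w). Proof. exact: mom2M. Qed.
Let E2 u : Ex P (fun w => L u w ^+ 2) = c u u.
Proof. by case: (xC u) => _ _ -> _; rewrite qformE. Qed.
Let E4 u : Ex P (fun w => L u w ^+ 4) = 3 * c u u ^+ 2.
Proof. by case: (xC u) => _ _ _ ->; rewrite qformE. Qed.

Let ExL2 a b X Y : itg P X -> itg P Y ->
  Ex P (fun w => a * X w + b * Y w) = a * Ex P X + b * Ex P Y.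
Proof. by move=> iX iY; rewrite ExD ?ExZ//; exact: itgZ. Qed.

Lemma wick2 u v : Ex P (fun w => L u w * L v w) = c u v.
Proof.
have -> : (fun w => L u w * L v w) =
    (fun w => 4^-1 * L (u + v) w ^+ 2 + - 4^-1 * L (u - v) w ^+ 2).
  by apply/funext => w; rewrite LD LB; field.
rewrite ExL2; [|exact: i2|exact: i2].
by rewrite !E2 !(cDl, cDr, cNl, cNr) (cC v u); field.
Qed.

Let E22 u v : Ex P (fun w => L u w ^+ 2 * L v w ^+ 2) =
  c u u * c v v + 2 * c u v ^+ 2.
Proof.
have -> : (fun w => L u w ^+ 2 * L v w ^+ 2) =
    (fun w => 1 * (12^-1 * L (u + v) w ^+ 4 + 12^-1 * L (u - v) w ^+ 4) +
              1 * (- 6^-1 * L u w ^+ 4 + - 6^-1 * L v w ^+ 4)).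
  by apply/funext => w; rewrite LD LB; field.
have i := fun a b u v => itgD (itgZ a (i4 u)) (itgZ b (i4 v)).
rewrite ExL2; [|exact: i|exact: i].
rewrite !ExL2; try exact: i4.
by rewrite !E4 !(cDl, cDr, cNl, cNr) (cC v u); field.
Qed.

Let E211 u v z : Ex P (fun w => L u w ^+ 2 * (L v w * L z w)) =
  c u u * c v z + 2 * c u v * c u z.
Proof.
have -> : (fun w => L u w ^+ 2 * (L v w * L z w)) =
    (fun w => 4^-1 * (L u w ^+ 2 * L (v + z) w ^+ 2) +
            - 4^-1 * (L u w ^+ 2 * L (v - z) w ^+ 2)).
  by apply/funext => w; rewrite LD LB; field.
have i v' : itg P (fun w => L u w ^+ 2 * L v' w ^+ 2).
  by under eq_fun do rewrite !expr2; exact: itgM.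
rewrite ExL2; [|exact: i|exact: i].
by rewrite !E22 !(cDl, cDr, cNl, cNr) (cC z v); field.
Qed.

(** Isserlis' formula, by polarization in three steps: squares of two forms, then a
    square times a product, then four distinct forms. Only moments of linear forms
    enter. *)
Lemma wick4 u v z t : Ex P (fun w => (L u w * L v w) * (L z w * L t w)) =
  c u v * c z t + c u z * c v t + c u t * c v z.
Proof.
have -> : (fun w => (L u w * L v w) * (L z w * L t w)) =
    (fun w => 4^-1 * (L (u + v) w ^+ 2 * (L z w * L t w)) +
            - 4^-1 * (L (u - v) w ^+ 2 * (L z w * L t w))).
  by apply/funext => w; rewrite LD LB; field.
have i u' : itg P (fun w => L u' w ^+ 2 * (L z w * L t w)).
  by under eq_fun do rewrite expr2; exact: itgM.
rewrite ExL2; [|exact: i|exact: i].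
by rewrite !E211 !(cDl, cDr, cNl, cNr) (cC v u); field.
Qed.

Variables (n : nat) (F G : 'M[R]_(n, k)).
Let K := F *m C *m G^T.

Let f i : 'cV[R]_k := (row i F)^T.
Let g i : 'cV[R]_k := (row i G)^T.

Let c_entry (F' G' : 'M[R]_(n, k)) i j :
  c (row i F')^T (row j G')^T = (F' *m C *m G'^T) i j.
Proof.
rewrite /c /dot trmxK mulmxA -row_mul [LHS]mxE [RHS]mxE.
by apply: eq_bigr => l _; rewrite !mxE.
Qed.

Let dot_sum w : dot (F *m x w) (G *m x w) = \sum_i L (f i) w * L (g i) w.
Proof.
rewrite dotE; apply: eq_bigr => i _.
have row_dot (F' : 'M[R]_(n, k)) : (F' *m x w) i 0 = L (row i F')^T w.
  by rewrite /L dotE mxE; apply: eq_bigr => l _; rewrite !mxE.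
by rewrite !row_dot.
Qed.

(** Of the three pairings of Isserlis' formula, the first gives the square of the
    mean and the other two the variance. *)
Lemma dot_moments : [/\ mom P 2 (fun w => dot (F *m x w) (G *m x w)),
  Ex P (fun w => dot (F *m x w) (G *m x w)) = \tr K &
  Ex P (fun w => (dot (F *m x w) (G *m x w) - \tr K) ^+ 2) =
    \tr ((F *m C *m F^T) *m (G *m C *m G^T)) + \tr (K *m K)].
Proof.
have m2s : mom P 2 (fun w => dot (F *m x w) (G *m x w)).
  under eq_fun do rewrite dot_sum.
  by apply: mom_sum => [|i]; [exact: mom2D|exact: m22].
have E1 : Ex P (fun w => dot (F *m x w) (G *m x w)) = \tr K.
  under eq_fun do rewrite dot_sum.
  rewrite Ex_sum => [|i]; last exact: itgM.
  by apply: eq_bigr => i _; rewrite wick2 c_entry.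
split=> //.
have -> : (fun w => (dot (F *m x w) (G *m x w) - \tr K) ^+ 2) =
    (fun w => 1 * dot (F *m x w) (G *m x w) ^+ 2 +
      (- \tr K) * (2 * dot (F *m x w) (G *m x w) + (- \tr K))).
  by apply/funext => w; ring.
have i1s := mom1P (mom21 m2s).
have [ms i2s] := m2s.
rewrite ExL2//; last by apply: itgD; [exact: itgZ|exact: itg_cst].
rewrite ExD ?ExZ ?Ex_cst ?E1//; [|exact: itgZ|exact: itg_cst].
have -> : Ex P (fun w => dot (F *m x w) (G *m x w) ^+ 2) =
    \tr K ^+ 2 + (\tr ((F *m C *m F^T) *m (G *m C *m G^T)) + \tr (K *m K)).
  under eq_fun do rewrite dot_sum expr2 mulr_suml.
  under eq_fun do under eq_bigr do rewrite mulr_sumr.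
  rewrite Ex_sum => [|i]; last by apply: itg_sum => j; exact: itgM.
  rewrite expr2 {1}/mxtrace mulr_suml -!big_split /=; apply: eq_bigr => i _.
  rewrite Ex_sum => [|j]; last exact: itgM.
  rewrite {1}/mxtrace mulr_sumr [X in _ = _ + (X + _)]mxE
    [X in _ = _ + (_ + X)]mxE -!big_split /=; apply: eq_bigr => j _.
  by rewrite wick4 (cC (g i) (g j)) (cC (g i) (f j)) !c_entry -/K addrA.
ring.
Qed.
End Wick.

(** * Smallness in probability *)

Section SmallInProbability.
Context {R : realType} {d : nat -> measure_display}
  {T : forall n, measurableType (d n)} (P : forall n, probability (T n) R).
Variable r : nat -> R.
Implicit Types X Y W : forall n, T n -> R.

Lemma measurable_lt n (X Y : T n -> R) : measurable_fun setT X ->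
  measurable_fun setT Y -> measurable [set w | X w < Y w].
Proof.
move=> mX mY; have := measurable_fun_ltr mX mY measurableT (Y := [set true]).
by rewrite setTI; exact.
Qed.

Lemma measurable_gt_norm n (X : T n -> R) (a : R) : measurable_fun setT X ->
  measurable [set w | a < `|X w|].
Proof. by move=> mX; apply: measurable_lt => //; exact: measurableT_comp. Qed.

Lemma markov_Ex n (X : T n -> R) (a : R) : measurable_fun setT X ->
  itg (P n) (fun w => `|X w|) -> 0 < a ->
  (P n [set w | (a < `|X w|)%R] <= (Ex (P n) (fun w => `|X w|%R) / a)%:E)%E.
Proof.
move=> mX iX a0.
have mA := measurable_gt_norm a mX.
have iA : itg (P n) (fun w => a * \1_[set w | a < `|X w|] w).
  apply: itgZ; apply: itg_le (itg_cst _ 1) _; first exact: measurable_indic.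
  by move=> w; rewrite ger0_norm// indicE; case: (_ \in _).
have le : Ex (P n) (fun w => a * \1_[set w | a < `|X w|] w) <=
    Ex (P n) (fun w => `|X w|).
  apply: Ex_le => // w; rewrite indicE; have [|] := boolP (_ \in _).
    by rewrite inE /= mulr1 => /ltW.
  by rewrite mulr0.
have iI : itg (P n) (\1_[set w | a < `|X w|] : T n -> R).
  apply: itg_le (itg_cst _ 1) _; first exact: measurable_indic.
  by move=> w; rewrite ger0_norm// indicE; case: (_ \in _).
rewrite -[leLHS]fineK ?fin_num_measure// lee_fin ler_pdivlMr// mulrC.
apply: le_trans le; rewrite ExZ// ler_pM2l// /Ex /Rintegral.
by rewrite integral_indic// setIT.
Qed.

(** [X_n = o_p(r_n)] for a deterministic sequence [r]. Measurability is part of the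
    definition because the union bounds below are between measures of events. *)
Definition negl X := (forall n, measurable_fun setT (X n)) /\
  forall e : R, 0 < e ->
    (fun n => P n [set w | e * r n < `|X n w|]) @ \oo --> 0%E.

Hypothesis r0 : \forall n \near \oo, 0 < r n.

Lemma negl_L1 X : (forall n, measurable_fun setT (X n)) ->
  (forall n, itg (P n) (fun w => `|X n w|)) ->
  (fun n => Ex (P n) (fun w => `|X n w|) / r n) @ \oo --> 0 -> negl X.
Proof.
move=> mX iX cX; split=> // e e0.
apply: (@squeeze_cvge _ _ _ _ (cst 0%E) _
  (fun n => (e^-1 * (Ex (P n) (fun w => `|X n w|) / r n))%:E)).
- near=> n; have rn : 0 < r n by near: n.
  rewrite measure_ge0 /= (le_trans (markov_Ex (mX n) (iX n) _)) ?mulr_gt0//.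
  by rewrite lee_fin invfM mulrCA.
- exact: cvg_cst.
- apply: cvg_EFin; first exact: nearW.
  by rewrite -[X in _ --> X](mulr0 e^-1); exact: cvgMr.
Unshelve. all: by end_near. Qed.

Lemma negl_L2 X : (forall n, mom (P n) 2 (X n)) ->
  (fun n => Ex (P n) (fun w => X n w ^+ 2) / r n ^+ 2) @ \oo --> 0 -> negl X.
Proof.
move=> mX cX; split=> [n|e e0]; first by case: (mX n).
apply: (@squeeze_cvge _ _ _ _ (cst 0%E) _
  (fun n => (e ^- 2 * (Ex (P n) (fun w => X n w ^+ 2) / r n ^+ 2))%:E)).
- near=> n; have rn : 0 < r n by near: n.
  have [mXn iXn] := mX n.
  have sqE : (fun w => `|X n w ^+ 2|) = (fun w => X n w ^+ 2).
    by apply/funext => w; rewrite ger0_norm ?sqr_ge0.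
  have h := @markov_Ex n (fun w => X n w ^+ 2) ((e * r n) ^+ 2)
    (measurable_funX _ mXn).
  rewrite sqE in h; rewrite measure_ge0 /=.
  apply: le_trans (_ : _ <= P n [set w | ((e * r n) ^+ 2 < `|X n w ^+ 2|)%R])%E _.
    rewrite le_measure// ?inE.
    - exact: measurable_gt_norm.
    - by apply: measurable_gt_norm; exact: measurable_funX.
    - move=> w /= ew; rewrite normrX ltr_sqr ?nnegrE//.
      by rewrite mulr_ge0// ltW.
  apply: le_trans (h iXn _) _; first by rewrite exprn_gt0// mulr_gt0.
  by rewrite lee_fin exprMn invfM mulrCA.
- exact: cvg_cst.
- apply: cvg_EFin; first exact: nearW.
  by rewrite -[X in _ --> X](mulr0 (e ^- 2)); exact: cvgMr.
Unshelve. all: by end_near. Qed.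

Lemma prob_cvg0_cover (A B C : forall n, set (T n)) :
  (forall n, measurable (A n)) -> (forall n, measurable (B n)) ->
  (forall n, measurable (C n)) ->
  (\forall n \near \oo, A n `<=` B n `|` C n) ->
  (fun n => P n (B n)) @ \oo --> 0%E -> (fun n => P n (C n)) @ \oo --> 0%E ->
  (fun n => P n (A n)) @ \oo --> 0%E.
Proof.
move=> mA mB mC ABC cB cC.
apply: (@squeeze_cvge _ _ _ _ (cst 0%E) _ (fun n => P n (B n) + P n (C n))%E).
- near=> n; rewrite measure_ge0 /=.
  apply: le_trans (_ : _ <= P n (B n `|` C n))%E (measureU2 _ _ _) => //.
  rewrite le_measure// ?inE//; first exact: measurableU.
  by near: n.
- exact: cvg_cst.
- by rewrite -[X in _ --> X](adde0 0%E); apply: cvgeD.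
Unshelve. all: by end_near. Qed.

Lemma neglD X Y : negl X -> negl Y -> negl (fun n w => X n w + Y n w).
Proof.
move=> [mX cX] [mY cY]; split=> [n|e e0]; first exact: measurable_funD.
have e2 : 0 < e / 2 by rewrite divr_gt0.
apply: (prob_cvg0_cover _ _ _ _ (cX _ e2) (cY _ e2)) => [n|n|n|].
- by apply: measurable_gt_norm; exact: measurable_funD.
- exact: measurable_gt_norm.
- exact: measurable_gt_norm.
near=> n => w /= eXY.
have [|Xe] := ltP (e / 2 * r n) `|X n w|; first by left.
right; have := ler_normD (X n w) (Y n w).
have -> : e / 2 * r n = e * r n - e / 2 * r n by lra.
by rewrite ltrBlDl => h; apply: lt_le_trans eXY _; apply: le_trans h _; rewrite lerD2r.
Unshelve. all: by end_near. Qed.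

Lemma neglZ (a : nat -> R) (c : R) X : 0 < c ->
  (\forall n \near \oo, `|a n| <= c) -> negl X -> negl (fun n w => a n * X n w).
Proof.
move=> c0 ac [mX cX]; split=> [n|e e0]; first exact: measurable_funM.
have ec : 0 < e / c by rewrite divr_gt0.
apply: (prob_cvg0_cover _ _ _ _ (cX _ ec) (cX _ ec)) => [n|n|n|].
- by apply: measurable_gt_norm; exact: measurable_funM.
- exact: measurable_gt_norm.
- exact: measurable_gt_norm.
near=> n => w /= eX; left.
have an : `|a n| <= c by near: n.
rewrite mulrAC ltr_pdivrMr//; apply: lt_le_trans eX _.
by rewrite normrM mulrC ler_wpM2l.
Unshelve. all: by end_near. Qed.

Lemma negl_det (a : nat -> R) : (fun n => a n / r n) @ \oo --> 0 ->
  negl (fun n _ => a n).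
Proof.
move=> ca; split=> [n|e e0]; first exact: measurable_cst.
apply: cvg_near_cst.
have /cvgr0Pnorm_lt/(_ e e0) ae := ca.
near=> n; have rn : 0 < r n by near: n.
have aen : `|a n / r n| < e by near: n.
rewrite /= (_ : [set _ | _] = set0) ?measure0//.
rewrite -subset0 => w /=; apply/negP; rewrite -leNgt.
by move: aen; rewrite normrM normfV (gtr0_norm rn) ltr_pdivrMr// => /ltW.
Unshelve. all: by end_near. Qed.

Lemma negl_near X Y : (forall n, measurable_fun setT (Y n)) ->
  (\forall n \near \oo, forall w, Y n w = X n w) -> negl X -> negl Y.
Proof.
move=> mY XY [mX cX]; split=> // e e0.
apply: (prob_cvg0_cover _ _ _ _ (cX _ e0) (cX _ e0)) => [n|n|n|].
- exact: measurable_gt_norm.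
- exact: measurable_gt_norm.
- exact: measurable_gt_norm.
near=> n => w /=; left.
have XYn : forall w, Y n w = X n w by near: n.
by rewrite -XYn.
Unshelve. all: by end_near. Qed.

(** On the event [|W - r| <= r / 2] one has [W >= r / 2 > 0], so that dividing by [W]
    costs at most a factor two compared with dividing by [r]. *)
Lemma is_op_of_negl X W : (forall n, measurable_fun setT (W n)) -> negl X ->
  negl (fun n w => W n w - r n) -> is_op P X W.
Proof.
move=> mW [mX cX] [mWr cW] e e0.
have e2 : 0 < e / 2 by rewrite divr_gt0.
have h2 : 0 < 2^-1 :> R by rewrite invr_gt0.
apply: (prob_cvg0_cover _ _ _ _ (cX _ e2) (cW _ h2)) => [n|n|n|].
- rewrite (_ : mkset _ = [set w | W n w = 0] `|`
      ([set w | e * `|W n w| < `|X n w|] `\` [set w | W n w = 0])).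
    have m0 : measurable [set w | W n w = 0].
      have := mW n measurableT [set 0] (measurable_set1 _).
      by rewrite setTI.
    apply: measurableU => //; apply: measurableD => //; apply: measurable_lt.
      by apply: measurable_funM => //; exact: measurableT_comp.
    exact: measurableT_comp.
  apply/seteqP; split=> w /=.
    have [->|W0] := eqVneq (W n w) 0; first by left.
    case=> [/eqP|eX]; first by rewrite (negbTE W0).
    right; split; last exact/eqP.
    by move: eX; rewrite normrM normfV ltr_pdivlMr// normr_gt0.
  move=> [|[+ /eqP W0]]; first by left.
  by right; rewrite normrM normfV ltr_pdivlMr// normr_gt0.
- exact: measurable_gt_norm.
- exact: measurable_gt_norm.
near=> n => w /= h; have rn : 0 < r n by near: n.
have [|Wr] := ltP (2^-1 * r n) `|W n w - r n|; first by right.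
left; have Wlb : 2^-1 * r n <= W n w.
  by move: Wr; rewrite ler_norml => /andP[]; lra.
have W0 : 0 < W n w by apply: lt_le_trans Wlb; rewrite mulr_gt0.
case: h => [W00|]; first by rewrite W00 ltxx in W0.
rewrite normrM normfV (gtr0_norm W0) ltr_pdivlMr//; apply: le_lt_trans.
by rewrite -mulrA ler_pM2l.
Unshelve. all: by end_near. Qed.

End SmallInProbability.

(** * From variance bounds to the two scores *)

Section RiskEstimates.
Context {R : realType} {d : nat -> measure_display}
  {T : forall n, measurableType (d n)} (P : forall n, probability (T n) R).
Variables (L1 L3 U err : forall n, T n -> R) (sigma2 c : R).
Arguments L1 : clear implicits.
Arguments L3 : clear implicits.
Arguments U : clear implicits.
Arguments err : clear implicits.
Let r n := Ex (P n) (L1 n).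
Let r3 n := Ex (P n) (L3 n).
Hypothesis sigma20 : 0 < sigma2.
Hypothesis mL1 : forall n, mom (P n) 2 (L1 n).
Hypothesis mL3 : forall n, measurable_fun setT (L3 n).
Hypothesis L31 : forall n w, 0 <= L3 n w <= L1 n w.
Hypothesis m2U : forall n, mom (P n) 2 (fun w => U n w - L1 n w - err n w).
Hypothesis m2err : forall n, mom (P n) 2 (fun w => err n w - sigma2).
Hypothesis varL1 : forall n, Ex (P n) (fun w => (L1 n w - r n) ^+ 2) <= c * r n / n%:R.
Hypothesis varU : forall n,
  Ex (P n) (fun w => (U n w - L1 n w - err n w) ^+ 2) <= c * r n / n%:R.
Hypothesis varerr : forall n, (0 < n)%N ->
  Ex (P n) (fun w => (err n w - sigma2) ^+ 2) <= c / n%:R.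
Hypothesis nr : (fun n => n%:R * r n) @ \oo --> +oo.
Hypothesis r3o : forall e : R, 0 < e -> \forall n \near \oo, `|r n - r3 n| <= e * `|r n|.

Let r0 : \forall n \near \oo, 0 < r n.
Proof.
have /cvgryPgt/(_ 0) h := nr; near=> n.
have : 0 < n%:R * r n by near: n.
by have := ler0n R n; rewrite le_eqVlt => /predU1P[<-|/pmulr_rgt0 ->//];
  rewrite mul0r ltxx.
Unshelve. all: by end_near. Qed.

Let inv_nr (k : R) : (fun n => k / (n%:R * r n)) @ \oo --> 0.
Proof.
rewrite -[X in _ --> X](mulr0 k); apply: cvgMr.
apply/gtr0_cvgV0 => //; by have /cvgryPgt/(_ 0) := nr.
Qed.

(** Chebyshev: [E X^2 <= c r / n] is [o(r^2)] because [n r] tends to infinity. *)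
Let small2 X : (forall n, mom (P n) 2 (X n)) ->
  (forall n, Ex (P n) (fun w => X n w ^+ 2) <= c * r n / n%:R) -> negl P r X.
Proof.
move=> mX EX; apply: negl_L2 => //.
apply: (@squeeze_cvgr _ _ _ _ (cst 0) (fun n => c / (n%:R * r n))).
- near=> n; have rn : 0 < r n by near: n.
  have n0 : 0 < n%:R :> R by rewrite ltr0n; near: n; exact: nbhs_infty_gt.
  rewrite mulr_ge0 ?invr_ge0 ?sqr_ge0//=; last first.
    by apply: Ex_ge0 => w; exact: sqr_ge0.
  rewrite ler_pdivrMr ?exprn_gt0//; apply: le_trans (EX n) _.
  rewrite le_eqVlt; apply/orP; left; apply/eqP; field.
  by rewrite !gt_eqF.
- exact: cvg_cst.
- exact: inv_nr.
Unshelve. all: by end_near. Qed.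

Let mL1' n : measurable_fun setT (L1 n). Proof. by case: (mL1 n). Qed.

Let iL1 n : itg (P n) (L1 n). Proof. exact/mom1P/mom21. Qed.

Let iL3 n : itg (P n) (L3 n).
Proof.
apply: itg_le (iL1 n) _ => // w.
by have /andP[L30 L3L1] := L31 w; rewrite ger0_norm.
Qed.

Let L1_small : negl P r (fun n w => L1 n w - r n).
Proof.
apply: small2 => // n.
by apply: mom2D; [exact: mL1|exact: mom_cst].
Qed.

(** The mean of the nonnegative variable [L1 - L3] is [r - r3]. *)
Let L13_small : negl P r (fun n w => L1 n w - L3 n w).
Proof.
have absE n : (fun w => `|L1 n w - L3 n w|) = (fun w => L1 n w + -1 * L3 n w).
  apply/funext => w; have /andP[_ L3L1] := L31 w.
  by rewrite ger0_norm ?subr_ge0// mulN1r.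
apply: negl_L1 => //.
- by move=> n; exact: measurable_funB.
- by move=> n; rewrite absE; apply: itgD => //; exact: itgZ.
apply/cvgr0Pnorm_le => e e0; have h := r3o e0.
near=> n; have rn : 0 < r n by near: n.
rewrite absE ExD ?ExZ//; last exact: itgZ.
rewrite mulN1r normrM normfV (gtr0_norm rn) ler_pdivrMr//.
by rewrite -[X in _ <= _ * X](gtr0_norm rn); near: n.
Unshelve. all: by end_near. Qed.

Let L3_small : negl P r (fun n w => L3 n w - r n).
Proof.
have h := neglD L1_small (@neglZ _ _ _ _ _ (fun=> -1) 1 _ ltr01 _ L13_small).
apply: negl_near (h _) => //.
- by move=> n; exact: measurable_funB.
- by apply: nearW => n w /=; ring.
- by apply: nearW => n; rewrite normrN normr1.
Qed.

Let U_small : negl P r (fun n w => U n w - L3 n w - err n w).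
Proof.
have h := neglD (small2 m2U varU) L13_small.
apply: negl_near (h) => //.
  move=> n; have -> : (fun w => U n w - L3 n w - err n w) =
      (fun w => (U n w - L1 n w - err n w) + (L1 n w - L3 n w)).
    by apply/funext => w; ring.
  by case: h => + _; exact.
by apply: nearW => n w /=; ring.
Qed.

Lemma U_is_op : is_op P (fun n w => U n w - L3 n w - err n w) L3.
Proof. exact: (is_op_of_negl r0 mL3 U_small L3_small). Qed.

(** Intended for [m = tr A / n] and [m2 = tr A^2 / n]. The two scores differ by
    [al (U - sigma2) - be] where [al -> 0] and [be = o(r)]; the part of
    [al (U - sigma2)] that comes from [err - sigma2], of order [n^-1/2], is small
    because [al^2] is of order [m^2], that is [o(r)]. *)
Lemma V_is_op (V : forall n, T n -> R) (m m2 : nat -> R) :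
  (forall n, measurable_fun setT (V n)) ->
  (\forall n \near \oo, forall w,
    V n w = (U n w - 2 * sigma2 * m n) / (1 - m n) ^+ 2) ->
  (forall n, 0 <= m2 n <= m n) -> (forall n, m2 n = 0 -> m n = 0) ->
  (forall n, sigma2 * m2 n <= r n) ->
  (fun n => m n ^+ 2 / m2 n) @ \oo --> 0 ->
  is_op P (fun n w => V n w - L3 n w - err n w) L3.
Proof.
move=> mV VE m2m m20 m2r rho0; apply: (is_op_of_negl r0 mL3 _ L3_small).
pose rho n := m n ^+ 2 / m2 n.
have m_ge0 n : 0 <= m n by case/andP: (m2m n) => h1 h2; exact: le_trans h2.
have sm n : 0 <= sigma2 * m2 n.
  by apply: mulr_ge0; [exact: ltW|case/andP: (m2m n)].
have r_ge0 n : 0 <= r n := le_trans (sm n) (m2r n).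
have msq n : m n ^+ 2 = rho n * m2 n.
  have [e0|nz] := eqVneq (m2 n) 0; last by rewrite /rho divfK.
  by rewrite (m20 _ e0) e0 expr0n/= mulr0.
have rho_ge0 n : 0 <= rho n.
  by case/andP: (m2m n) => h1 h2; rewrite divr_ge0// sqr_ge0.
have m_rho n : m n <= rho n.
  have := m_ge0 n; rewrite le_eqVlt => /predU1P[<-//|mn].
  rewrite -(ler_pM2l mn) -expr2 msq mulrC ler_wpM2r//.
  by case/andP: (m2m n).
(* Eventually m <= rho <= 1/2, hence (1 - m)^2 >= 1/4. *)
have rho_half : \forall n \near \oo, rho n <= 2^-1.
  have /cvgr0Pnorm_le/(_ 2^-1) := rho0; rewrite invr_gt0 => /(_ (ltr0n _ 2)).
  by apply: filterS => n; rewrite (ger0_norm (rho_ge0 n)).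
pose al n := (2 * m n - m n ^+ 2) / (1 - m n) ^+ 2.
pose be n := m n ^+ 2 * sigma2 / (1 - m n) ^+ 2.
have den n : rho n <= 2^-1 -> 4^-1 <= (1 - m n) ^+ 2.
  move=> hn; have hm := m_rho n; have m0 := m_ge0 n.
  have h : 2^-1 <= 1 - m n by lra.
  by nra.
have al_bnd n : rho n <= 2^-1 -> 0 <= al n <= 8 * m n.
  move=> h; have := den n h; have := m_rho n; have := m_ge0 n.
  move=> m0 mr dn; have d0 : 0 < (1 - m n) ^+ 2 by lra.
  rewrite divr_ge0 ?(ltW d0)//=; last by nra.
  by rewrite ler_pdivrMr//; nra.
have be_bnd n : rho n <= 2^-1 -> 0 <= be n <= 4 * rho n * r n.
  move=> h; have := den n h => dn; have d0 : 0 < (1 - m n) ^+ 2 by lra.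
  have ms0 : 0 <= m n ^+ 2 * sigma2 by rewrite mulr_ge0 ?sqr_ge0 ?ltW.
  rewrite divr_ge0 ?(ltW d0)//=.
  rewrite ler_pdivrMr//.
  apply: (@le_trans _ _ (rho n * r n)); last first.
    have : 0 <= rho n * r n.
      exact: mulr_ge0.
    by nra.
  by rewrite msq -mulrA ler_wpM2l// mulrC.
have al4 : \forall n \near \oo, `|al n| <= 4.
  near=> n; have hn : rho n <= 2^-1 by near: n.
  have /andP[h1 h2] := al_bnd n hn; rewrite ger0_norm//; have := m_rho n; lra.
have hA := neglZ (ltr0n _ 4) al4 U_small.
have hB := neglZ (ltr0n _ 4) al4 L3_small.
have hC : negl P r (fun n _ => al n * r n).
  apply: negl_det => //.
  apply: (@squeeze_cvgr _ _ _ _ (cst 0) (fun n => 8 * rho n)).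
  - near=> n; have hn : rho n <= 2^-1 by near: n.
    have rn : 0 < r n by near: n.
    have /andP[h1 h2] := al_bnd n hn; rewrite mulfK ?gt_eqF// h1 /=.
    by apply: le_trans h2 _; rewrite ler_pM2l.
  - exact: cvg_cst.
  - by rewrite -[X in _ --> X](mulr0 8); exact: cvgMr.
have hD : negl P r (fun n _ => - be n).
  apply: negl_det => //.
  apply: (@squeeze_cvgr _ _ _ _ (fun n => -4 * rho n) (cst 0)).
  - near=> n; have hn : rho n <= 2^-1 by near: n.
    have rn : 0 < r n by near: n.
    have /andP[h1 h2] := be_bnd n hn.
    rewrite !mulNr /= lerN2 oppr_le0 ler_pdivrMr// h2 /=.
    exact: divr_ge0 h1 (ltW rn).
  - by rewrite -[X in _ --> X](mulr0 (-4)); exact: cvgMr.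
  - exact: cvg_cst.
have hE : negl P r (fun n w => al n * (err n w - sigma2)).
  apply: negl_L2 => // [n|]; first exact: momZ.
  apply: (@squeeze_cvgr _ _ _ _ (cst 0) (fun n => 32 * c / sigma2 / (n%:R * r n))).
  - near=> n; have hn : rho n <= 2^-1 by near: n.
    have rn : 0 < r n by near: n.
    have n0 : 0 < n%:R :> R by rewrite ltr0n; near: n; exact: nbhs_infty_gt.
    under eq_fun do rewrite exprMn.
    rewrite ExZ; last by case: (m2err n).
    set E := Ex _ _; have E0 : 0 <= E by apply: Ex_ge0 => w; exact: sqr_ge0.
    have En : E <= c / n%:R by apply: varerr; rewrite -(ltr0n R).
    apply/andP; split.
      by apply: divr_ge0; [apply: mulr_ge0 => //|]; exact: sqr_ge0.
    rewrite ler_pdivrMr ?exprn_gt0//.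
    have /andP[al0 al8] := al_bnd n hn.
    have al2 : al n ^+ 2 <= 32 * r n / sigma2.
      apply: (@le_trans _ _ (64 * m n ^+ 2)).
        have -> : 64 * m n ^+ 2 = (8 * m n) ^+ 2 by ring.
        by rewrite ler_sqr ?nnegrE// mulr_ge0.
      rewrite msq ler_pdivlMr//; have := m2r n; have := rho_ge0 n.
      have := sm n.
      nra.
    apply: le_trans (ler_pM _ _ al2 En) _; rewrite ?sqr_ge0//.
    rewrite le_eqVlt; apply/orP; left; apply/eqP; field.
    by rewrite !gt_eqF.
  - exact: cvg_cst.
  - exact: inv_nr.
have h := neglD U_small (neglD hA (neglD hB (neglD hC (neglD hD hE)))).
apply: negl_near h => [n|].
  apply: measurable_funB; first exact: measurable_funB.
  have -> : err n = (fun w => err n w - sigma2 + sigma2).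
    by apply/funext => w; rewrite subrK.
  by apply: measurable_funD => //; case: (m2err n).
near=> n => w.
have hn : rho n <= 2^-1 by near: n.
have -> : V n w = (U n w - 2 * sigma2 * m n) / (1 - m n) ^+ 2.
  by move: w; near: n.
have d0 : 1 - m n != 0.
  by have := den n hn; apply: contraTneq => ->; rewrite expr0n /= -ltNge invr_gt0.
by rewrite /al /be; field.
Unshelve. all: by end_near. Qed.
End RiskEstimates.

(** * Estimates at a fixed sample size *)

Section Sample.
Context {R : realType} {X : Type}.
Variables (eta : X -> R) (H : set (X -> R)) (J : (X -> R) -> (X -> R) -> R).
Variables (n : nat) (D : design R X n).
Variables (d : measure_display) (T : measurableType d) (P : probability T R).
Variables (b : 'I_(dim1 D + dim2 D) -> {RV P >-> R}) (eps : 'I_n -> {RV P >-> R}).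
Variables (B : 'M[R]_(dim1 D + dim2 D)) (sigma2 : R).
Variables (lambda : R) (Sigma : 'M[R]_(dim1 D + dim2 D)) (KB K1 : R).
Hypotheses (HJ : square_seminorm H J) (Hxi : forall j : 'I_(nbasis D), H (xi j)).
Hypotheses (sigma20 : 0 < sigma2) (bB : gaussian_vector b B).
Hypothesis epsN : forall i, has_normal_law P (eps i) 0 sigma2.
Hypothesis indep : mutually_independent P (effects_errors b eps).
Hypotheses (lambda0 : 0 < lambda) (Sigma0 : pos_definite Sigma).
Hypotheses (KB0 : 0 <= KB) (K10 : 0 <= K1).
Hypothesis BK : forall a, eigenvalue B a -> a <= KB.
Hypothesis SigmaK : forall a, eigenvalue (Sigma
  *m invmx ((Zmx D)^T *m (1%:M - smoothing0_mx J D lambda) *m Zmx D + Sigma)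
  *m Sigma) a -> a <= K1.

Let Z := Zmx D.
Let A := smoothing_mx J D lambda Sigma.
Let N : 'M[R]_n := 1%:M - A.
Let en (w : T) := rvec eps w.
Let x (w : T) := col_mx (rvec b w) (rvec eps w).
Let C := block_mx B 0 0 (sigma2%:M : 'M[R]_n).
Let F : 'M[R]_(n, _) := row_mx (N *m Z) (- A).
Let G : 'M[R]_(n, _) := row_mx (0 : 'M[R]_(n, dim1 D + dim2 D)) 1%:M.
Let v := N *m etavec eta D.
Let t w := v + F *m x w.
Let Y w := response eta D (rvec b w) (rvec eps w).
Let L1 w := loss1 J eta D lambda Sigma (rvec b w) (rvec eps w).
Let L3 w := loss3 J eta D lambda Sigma (rvec b w) (rvec eps w).
Let U w := score_U J D lambda Sigma (Y w) sigma2.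
Let V w := score_V J D lambda Sigma (Y w).
Let err w := n%:R^-1 * ((en w)^T *m en w) 0 0.

Let D0 : nonneg_definite ((n%:R * lambda) *: Qmx J D).
Proof.
have [sQ Q0] := Qmx_nonneg_definite HJ Hxi; split; first by rewrite linearZ /= sQ.
move=> u; rewrite qformE -scalemxAl dotZr -qformE mulr_ge0// mulr_ge0//.
exact: ltW.
Qed.

Lemma smoothing_mxE : A = ridge (row_mx (Rmx D) Z)
  (block_mx ((n%:R * lambda) *: Qmx J D) 0 0 Sigma).
Proof.
rewrite /A /smoothing_mx /ridge /normal_mx tr_row_mx mul_col_row add_block_mx.
by rewrite !addr0.
Qed.

Let A_shrinking : shrinking A.
Proof.
rewrite smoothing_mxE; apply: ridge_shrinking; exact: block_nonneg_definite.
Qed.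

Let sA : A^T = A. Proof. exact: (proj1 A_shrinking). Qed.
Let sN : N^T = N. Proof. exact: (proj1 (shrinking_compl A_shrinking)). Qed.

Let Gx w : G *m x w = en w.
Proof. by rewrite mul_row_col mul0mx mul1mx add0r. Qed.

Let tE w : t w = N *m (etavec eta D + Z *m rvec b w) - A *m en w.
Proof. by rewrite /t /v /F mul_row_col mulmxDr mulNmx mulmxA addrA. Qed.

Let NY w : N *m Y w = t w + en w.
Proof.
rewrite tE /Y /response mulmxDr -[RHS]addrA; congr (_ + _).
by rewrite /N mulmxBl mul1mx addrC.
Qed.

(** Since [A Y = Y - N Y] and [N Y = t + e], the error [e] cancels. *)
Let fit_errorE w : Y_hat J lambda Sigma (Y w) - etavec eta D - Z *m rvec b w = - t w.
Proof.
have -> : Y_hat J lambda Sigma (Y w) = Y w - N *m Y w.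
  by rewrite Y_hatE -/A /N mulmxBl mul1mx opprB addrC subrK.
rewrite NY /Y /response -/Z; set u := etavec _ _; set z := Z *m _.
by apply/colP => i; rewrite !mxE; ring.
Qed.

Let L1E w : L1 w = n%:R^-1 * dot (t w) (t w).
Proof.
rewrite /L1 /loss1 dotE; congr (_ * _); apply: eq_bigr => i _.
have /(congr1 (fun M : 'cV[R]_n => M i 0)) := fit_errorE w.
rewrite -/(Y w) -row_mul; move: (Y_hat _ _ _ _) (t w) => yh tw.
by rewrite !mxE => ->; rewrite expr2 mulrNN.
Qed.

Let UE w : U w = L1 w + err w +
  2 * n%:R^-1 * (dot (t w) (en w) + sigma2 * \tr A).
Proof.
rewrite L1E /U /score_U -/A -/N qform_sqr// NY /err -/(dot _ _).
move: (t w) (en w) => tw ew; rewrite dotDl !dotDr (dotC ew tw); ring.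
Qed.

Lemma score_VE w : (0 < n)%N -> V w =
  (U w - 2 * sigma2 * (n%:R^-1 * \tr A)) / (1 - n%:R^-1 * \tr A) ^+ 2.
Proof.
move=> n0; have nn0 : n%:R != 0 :> R by rewrite pnatr_eq0 -lt0n.
rewrite /V /score_V -/A -/N /U /score_U -/A -/N.
have -> : n%:R^-1 * \tr N = 1 - n%:R^-1 * \tr A.
  by rewrite /N linearB /= mxtrace1 mulrBr mulVf.
by congr (_ / _); ring.
Qed.

Let Pp := proj_perp_Z2 D.

Let Pp_shrinking : shrinking Pp.
Proof.
have z0 : nonneg_definite (0 : 'M[R]_(dim2 D)) by exact: nonneg_definite0.
rewrite /Pp /proj_perp_Z2; apply: shrinking_compl.
by have := ridge_shrinking (Z2 D) z0; rewrite /ridge addr0.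
Qed.

Let PpZ2 : Pp *m Z2 D = 0.
Proof.
have z0 : nonneg_definite (0 : 'M[R]_(dim2 D)) by exact: nonneg_definite0.
have := @ridge_solution _ _ _ (Z2 D) _ z0 _ (Z2 D) 1%:M.
rewrite !mulmx1 addr0 => /(_ erefl); rewrite /ridge addr0 => h.
by rewrite /Pp /proj_perp_Z2 mulmxBl mul1mx h subrr.
Qed.

(** The estimation error differs from [- t] by an element of the range of [Z2], which
    the projection kills. *)
Let L3E w : L3 w = n%:R^-1 * qform Pp (t w).
Proof.
rewrite /L3 /loss3 -/Pp; congr (_ * _); rewrite -/(Y w).
set e3 := (X in qform _ X).
have e3E : e3 = - t w - Z2 D *m (dsubmx (b_hat J lambda Sigma (Y w)) - dsubmx (rvec b w)).
  have row_mulE u : Z *m u = Z1 D *m usubmx u + Z2 D *m dsubmx u.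
    by rewrite -[in LHS](vsubmxK u) mul_row_col.
  rewrite -fit_errorE /e3 /Y_hat /eta_hat -/Z !row_mulE mulmxBr.
  move: (Rmx D *m _) (Z1 D *m usubmx (b_hat _ _ _ _)) (Z2 D *m dsubmx (b_hat _ _ _ _)).
  move: (Z1 D *m _) (Z2 D *m _) (etavec _ _) => a1 a2 a3 a4 a5 a6.
  by apply/colP => i; rewrite !mxE; ring.
have PpE : Pp *m e3 = - (Pp *m t w).
  by rewrite e3E mulmxBr mulmxA PpZ2 mul0mx subr0 mulmxN.
by rewrite !qformE PpE dotNr dot_mulr (proj1 Pp_shrinking) PpE dotNl opprK dotC.
Qed.

(** An orthogonal projection decreases the norm. *)
Lemma loss3_le w : 0 <= L3 w <= L1 w.
Proof.
rewrite L3E L1E mulr_ge0 ?invr_ge0//=; last by case: (shrinking_nonneg Pp_shrinking).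
rewrite ler_wpM2l ?invr_ge0// qformE.
have /shrinking_nonneg[_ /(_ (t w))] := shrinking_compl Pp_shrinking.
by rewrite qformE mulmxBl mul1mx dotDr dotNr subr_ge0.
Qed.

Let M := F *m C *m F^T.

Let ME : M = N *m Z *m B *m (N *m Z)^T + sigma2 *: (A *m A).
Proof.
rewrite /M /F /C mul_row_block !mulmx0 addr0 add0r tr_row_mx mul_row_col.
by rewrite linearN /= sA mulmxN !mulNmx opprK mul_mx_scalar -scalemxAl.
Qed.

Let sB : B^T = B. Proof. by case: bB => -[]. Qed.

Let sC : C^T = C.
Proof. by rewrite /C tr_block_mx !trmx0 sB tr_scalar_mx. Qed.

Let qM u : qform M u = qform B ((N *m Z)^T *m u) + sigma2 * dot (A *m u) (A *m u).
Proof.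
rewrite ME qformD; congr (_ + _).
  by move: (N *m Z) => W; rewrite !qformE -!mulmxA dot_mulr.
by rewrite qformE -scalemxAl dotZr -mulmxA dot_mulr sA.
Qed.

Let kappa := KB * K1 + sigma2.

Let M_nonneg : nonneg_definite M.
Proof.
split=> [|u]; first by rewrite /M !trmx_mul trmxK sC mulmxA.
rewrite qM addr_ge0//; first by case: bB => -[].
by rewrite mulr_ge0 ?dot_ge0// ltW.
Qed.

Let kappa0 : 0 <= kappa. Proof. by rewrite addr_ge0 ?mulr_ge0// ltW. Qed.

(** The bounds on the spectra of [B] and of [Sigma (W + Sigma)^-1 Sigma] enter here, the
    latter through the operator norm of [N Z]. *)
Let M_le u : qform M u <= kappa * dot u u.
Proof.
rewrite qM mulrDl; apply: lerD; last first.
  by rewrite ler_pM2l//; exact: shrinking_norm_le.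
apply: le_trans (qform_le_eigenvalue sB BK _) _.
rewrite -mulrA ler_wpM2l//; apply: norm_mul_tr_le => // a.
rewrite /N smoothing_mxE; exact: residual_random_effects_le.
Qed.

(** The errors alone contribute [sigma^2 tr A^2] to the risk. *)
Let trM_ge : sigma2 * \tr (A *m A) <= \tr M.
Proof.
rewrite -mxtraceZ -subr_ge0 -linearB /= mxtrace_dot sumr_ge0// => i _.
rewrite ME addrK; move: (N *m Z) => W; rewrite -!mulmxA dot_mulr -qformE.
by case: bB => -[].
Qed.

Let xC u : gauss4 P (fun w => dot u (x w)) (qform C u).
Proof. exact: gauss4_linear_form (ltW sigma20) bB epsN indep u. Qed.

Let risk := n%:R^-1 * (dot v v + \tr M).

Let qform_lin (W : 'M[R]_(n, _)) u : qform C (W^T *m u) = qform (W *m C *m W^T) u.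
Proof. by rewrite !qformE -!mulmxA dot_mull trmxK. Qed.

Let lin_moments (W : 'M[R]_(n, _)) u : [/\ mom P 2 (fun w => dot u (W *m x w)),
  Ex P (fun w => dot u (W *m x w)) = 0 &
  Ex P (fun w => dot u (W *m x w) ^+ 2) = qform C (W^T *m u)].
Proof.
have [h1 h2 h3 _] := xC (W^T *m u).
split; under eq_fun do rewrite dot_mulr; [exact: mom42|exact: h2|exact: h3].
Qed.

Let Ex_sqrD_le Q1 Q2 : mom P 2 Q1 -> mom P 2 Q2 ->
  Ex P (fun w => (Q1 w + Q2 w) ^+ 2) <=
  2 * (Ex P (fun w => Q1 w ^+ 2) + Ex P (fun w => Q2 w ^+ 2)).
Proof.
move=> m1 m2; have [_ i1] := m1; have [_ i2] := m2; have [_ i12] := mom2D m1 m2.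
rewrite -ExD// -ExZ; last exact: itgD.
apply: Ex_le => //; first exact/itgZ/itgD.
by move=> w; exact: sqr_add_le.
Qed.

Let GCG : G *m C *m G^T = sigma2%:M.
Proof.
rewrite /G /C mul_row_block !mulmx0 !mul0mx addr0 add0r mul1mx tr_row_mx mul_row_col.
by rewrite mul0mx add0r trmx1 mulmx1.
Qed.

Let FCG : F *m C *m G^T = - (sigma2 *: A).
Proof.
rewrite /F /G /C mul_row_block !mulmx0 addr0 add0r tr_row_mx mul_row_col.
by rewrite trmx0 mulmx0 add0r trmx1 mulmx1 mulNmx mul_mx_scalar.
Qed.

Let mFF := @dot_moments _ _ _ P _ x C sC xC n F F.
Let mFG := @dot_moments _ _ _ P _ x C sC xC n F G.
Let mGG := @dot_moments _ _ _ P _ x C sC xC n G G.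

Let L1_split w : L1 w = n%:R^-1 *
  ((dot v v + 2 * dot v (F *m x w)) + dot (F *m x w) (F *m x w)).
Proof.
rewrite L1E /t; move: (F *m x w) => y; rewrite dotDl !dotDr (dotC y v); ring.
Qed.

Let m2v : mom P 2 (fun w => dot v v + 2 * dot v (F *m x w)).
Proof.
have [m2l _ _] := lin_moments F v.
by apply: mom2D; [exact: mom_cst|exact: momZ].
Qed.

Lemma mom2_loss1 : mom P 2 L1.
Proof.
have [m2q _ _] := mFF.
have -> : L1 = (fun w => n%:R^-1 *
    ((dot v v + 2 * dot v (F *m x w)) + dot (F *m x w) (F *m x w))).
  by apply/funext => w; exact: L1_split.
by apply: momZ; exact: mom2D.
Qed.

Lemma Ex_loss1 : Ex P L1 = risk.
Proof.
have [m2q Eq _] := mFF; have [m2l El _] := lin_moments F v.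
have iq := mom1P (mom21 m2q); have il := mom1P (mom21 m2l).
have -> : L1 = (fun w => n%:R^-1 *
    ((dot v v + 2 * dot v (F *m x w)) + dot (F *m x w) (F *m x w))).
  by apply/funext => w; exact: L1_split.
rewrite ExZ; last by apply: itgD => //; exact/mom1P/mom21.
rewrite ExD//; last exact/mom1P/mom21.
rewrite ExD; [|exact: itg_cst|exact: itgZ].
by rewrite Ex_cst ExZ// El Eq mulr0 addr0.
Qed.

Let trM0 : 0 <= \tr M.
Proof.
rewrite mxtrace_dot sumr_ge0// => i _.
by rewrite -qformE; case: M_nonneg.
Qed.

(** Both the linear and the quadratic part of [|v + F x|^2] have variance at most a
    multiple of [kappa (|v|^2 + tr M)]. *)
Lemma var_loss1 :
  Ex P (fun w => (L1 w - Ex P L1) ^+ 2) <= 8 * kappa * Ex P L1 / n%:R.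
Proof.
rewrite Ex_loss1.
have [m2q Eq Vq] := mFF; have [m2l El Vl] := lin_moments F v.
have m2q' : mom P 2 (fun w => dot (F *m x w) (F *m x w) - \tr M).
  by apply: mom2D => //; exact: mom_cst.
have -> : (fun w => (L1 w - risk) ^+ 2) = (fun w => n%:R^-1 ^+ 2 *
    (2 * dot v (F *m x w) + (dot (F *m x w) (F *m x w) - \tr M)) ^+ 2).
  by apply/funext => w; rewrite L1_split /risk; ring.
rewrite ExZ; last by case: (mom2D (momZ 2 m2l) m2q').
have -> : 8 * kappa * risk / n%:R = n%:R^-1 ^+ 2 * (8 * kappa * (dot v v + \tr M)).
  by rewrite /risk; ring.
rewrite ler_wpM2l ?sqr_ge0//; apply: le_trans (Ex_sqrD_le (momZ 2 m2l) m2q') _.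
under [X in Ex P X + _]eq_fun do rewrite exprMn.
rewrite ExZ; last by case: m2l.
rewrite Vl qform_lin Vq -/M.
have := mulr_ge0 kappa0 trM0.
have := mxtrace_sqr_le M_nonneg M_le; have := M_le v.
rewrite -(mulrA 8) (mulrDr kappa).
move: (kappa * _) (kappa * _) (qform M v) (\tr (M *m M)) => a1 a2 a3 a4 h1 h2 h3.
by lra.
Qed.

Let U_split w : U w - L1 w - err w = 2 * n%:R^-1 *
  (dot v (G *m x w) + (dot (F *m x w) (G *m x w) + sigma2 * \tr A)).
Proof. by rewrite UE -Gx /t; rewrite dotDl; ring. Qed.

Let trFCG : \tr (F *m C *m G^T) = - (sigma2 * \tr A).
Proof. by rewrite FCG linearN linearZ. Qed.

Let m2FG : mom P 2 (fun w => dot (F *m x w) (G *m x w) + sigma2 * \tr A).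
Proof. by have [m2q _ _] := mFG; apply: mom2D => //; exact: mom_cst. Qed.

Lemma mom2_excess : mom P 2 (fun w => U w - L1 w - err w).
Proof.
under eq_fun do rewrite U_split; apply: momZ; apply: mom2D => //.
by have [] := lin_moments G v.
Qed.

(** The constant does not involve [kappa]: the second factor of [t'e] has covariance
    [sigma2 I]. *)
Lemma var_excess :
  Ex P (fun w => (U w - L1 w - err w) ^+ 2) <=
  16 * sigma2 * Ex P L1 / n%:R.
Proof.
rewrite Ex_loss1.
have [m2q Eq Vq] := mFG; have [m2l El Vl] := lin_moments G v.
under eq_fun do rewrite U_split exprMn.
rewrite ExZ; last by case: (mom2D m2l m2FG).
have -> : 16 * sigma2 * risk / n%:R =
    (2 * n%:R^-1) ^+ 2 * (4 * sigma2 * (dot v v + \tr M)).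
  by rewrite /risk; ring.
rewrite ler_wpM2l ?sqr_ge0//; apply: le_trans (Ex_sqrD_le m2l m2FG) _.
rewrite Vl; move: Vq; rewrite trFCG; under eq_fun do rewrite opprK.
move=> ->.
have -> : qform C (G^T *m v) = sigma2 * dot v v.
  by rewrite qform_lin GCG qformE mul_scalar_mx dotZr.
rewrite -/M GCG FCG mul_mx_scalar mulmxN mulNmx opprK -scalemxAl -scalemxAr !mxtraceZ.
have h1 : 0 <= sigma2 * dot v v by rewrite mulr_ge0 ?dot_ge0// ltW.
have h2 : sigma2 * (sigma2 * \tr (A *m A)) <= sigma2 * \tr M by rewrite ler_pM2l.
rewrite -(mulrA 4) (mulrDr sigma2); lra.
Qed.

Lemma mom2_err : mom P 2 (fun w => err w - sigma2).
Proof.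
have [m2q _ _] := mGG; apply: mom2D; last exact: mom_cst.
have -> : err = (fun w => n%:R^-1 * dot (G *m x w) (G *m x w)).
  by apply/funext => w; rewrite Gx.
exact: momZ.
Qed.

Lemma var_err : (0 < n)%N ->
  Ex P (fun w => (err w - sigma2) ^+ 2) <= 2 * sigma2 ^+ 2 / n%:R.
Proof.
move=> n0; have nn0 : n%:R != 0 :> R by rewrite pnatr_eq0 -lt0n.
have [m2q _ Vq] := mGG.
have m2q' : mom P 2 (fun w => dot (G *m x w) (G *m x w) - \tr (G *m C *m G^T)).
  by apply: mom2D => //; exact: mom_cst.
have -> : (fun w => (err w - sigma2) ^+ 2) = (fun w => n%:R^-1 ^+ 2 *
    (dot (G *m x w) (G *m x w) - \tr (G *m C *m G^T)) ^+ 2).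
  apply/funext => w; rewrite GCG mxtrace_scalar Gx /err -/(dot _ _).
  by rewrite -mulr_natr; field.
rewrite ExZ; last by case: m2q'.
rewrite Vq GCG mul_scalar_mx mxtraceZ mxtrace_scalar -mulr_natr.
by rewrite le_eqVlt; apply/orP; left; apply/eqP; field.
Qed.

Let mx_measurable m (W : 'M[R]_(m, _)) i : measurable_fun setT (fun w => (W *m x w) i 0).
Proof.
have -> : (fun w => (W *m x w) i 0) = (fun w => dot (W^T *m delta_mx i 0) (x w)).
  apply/funext => w; rewrite -dot_mulr dotE (bigD1 i)//= big1 ?addr0.
    by rewrite !mxE !eqxx mul1r.
  by move=> j ji; rewrite !mxE (negPf ji) mul0r.
by have [[]] := xC (W^T *m delta_mx i 0).
Qed.

Lemma measurable_loss3 : measurable_fun setT L3.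
Proof.
have -> : L3 = (fun w => n%:R^-1 * \sum_i (v i 0 + (F *m x w) i 0) *
    ((Pp *m v) i 0 + (Pp *m F *m x w) i 0)).
  apply/funext => w; rewrite L3E qformE dotE; congr (_ * _); apply: eq_bigr => i _.
  by rewrite /t mulmxDr mulmxA; congr (_ * _); rewrite [LHS]mxE.
apply: measurable_funM => //; apply: measurable_sum => i.
by apply: measurable_funM; apply: measurable_funD => //; exact: mx_measurable.
Qed.

Lemma measurable_score_U : measurable_fun setT U.
Proof.
have -> : U = (fun w => (U w - L1 w - err w) + L1 w + (err w - sigma2 + sigma2)).
  by apply/funext => w; ring.
apply: measurable_funD; last first.
  by apply: measurable_funD => //; case: mom2_err.
by apply: measurable_funD; [case: mom2_excess|case: mom2_loss1].
Qed.

Lemma measurable_score_V : measurable_fun setT V.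
Proof.
have -> : V = (fun w => (U w - 2 / n%:R * sigma2 * \tr A) *
    (((n%:R^-1 * \tr N) ^+ 2)^-1)).
  by apply/funext => w; rewrite /V /score_V /U /score_U -/A addrK.
by apply: measurable_funM => //; apply: measurable_funB => //; exact: measurable_score_U.
Qed.

Let tr_sqr : \tr (A *m A) = \sum_i dot (A *m delta_mx i 0) (A *m delta_mx i 0).
Proof. by rewrite mxtrace_dot; apply: eq_bigr => i _; rewrite -mulmxA dot_mulr sA. Qed.

Lemma trace_smoothing_sqr_le :
  0 <= n%:R^-1 * \tr (A *m A) <= n%:R^-1 * \tr A.
Proof.
rewrite tr_sqr mulr_ge0 ?invr_ge0//=; last by rewrite sumr_ge0// => i _; exact: dot_ge0.
rewrite ler_wpM2l ?invr_ge0// mxtrace_dot; apply: ler_sum => i _.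
exact: (proj2 A_shrinking).
Qed.

Lemma trace_smoothing_eq0 :
  n%:R^-1 * \tr (A *m A) = 0 -> n%:R^-1 * \tr A = 0.
Proof.
move=> /eqP; rewrite mulf_eq0 => /orP[/eqP->|]; first by rewrite mul0r.
rewrite tr_sqr psumr_eq0 => [/allP h|i _]; last exact: dot_ge0.
rewrite mxtrace_dot big1 ?mulr0// => i _.
have /= := h i (mem_index_enum i); rewrite dot_eq0 => /eqP ->.
by rewrite /dot mulmx0 mxE.
Qed.

Lemma trace_smoothing_risk : sigma2 * (n%:R^-1 * \tr (A *m A)) <= Ex P L1.
Proof.
rewrite Ex_loss1 mulrCA /risk ler_wpM2l ?invr_ge0//; apply: le_trans trM_ge _.
by rewrite lerDr dot_ge0.
Qed.

End Sample.

(** * Asymptotic equivalence of the scores with the loss *)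

Unset Implicit Arguments.
Set Strict Implicit.
Set Printing Implicit Defensive.

Theorem theorem4p4 (R : realType) (X : Type) (eta : X -> R)
  (H : set (X -> R)) (J : (X -> R) -> (X -> R) -> R)
  (D : forall n, design R X n)
  (d : nat -> measure_display) (T : forall n, measurableType (d n))
  (P : forall n, probability (T n) R)
  (b : forall n, 'I_(dim1 (D n) + dim2 (D n)) -> {RV (P n) >-> R})
  (eps : forall n, 'I_n -> {RV (P n) >-> R})
  (B : forall n, 'M[R]_(dim1 (D n) + dim2 (D n))) (sigma2 : R)
  (lambda : nat -> R) (Sigma : forall n, 'M[R]_(dim1 (D n) + dim2 (D n))) :
  square_seminorm H J ->
  (forall n (j : 'I_(nbasis (D n))), H (xi j)) ->
  0 < sigma2 ->
  (forall n, gaussian_vector (b n) (B n)) ->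
  (exists K : R, forall n (a : R), eigenvalue (B n) a -> `|a| <= K) ->
  (forall n i, has_normal_law (P n) (eps n i) 0 sigma2) ->
  (forall n, mutually_independent (P n) (effects_errors (b n) (eps n))) ->
  (forall n, independent (P n)
     (sigma_of (fun j => b n (lshift _ j)))
     (sigma_of (fun j => b n (rshift _ j)))) ->
  (forall n, 0 < lambda n) ->
  (forall n, pos_definite (Sigma n)) ->
  (forall n, solvable_normal_eq J (D n) (lambda n) (Sigma n)) ->
  let Z n := Zmx (D n) in
  let A0 n := smoothing0_mx J (D n) (lambda n) in
  let A n := smoothing_mx J (D n) (lambda n) (Sigma n) in
  let bn n (w : T n) := rvec (b n) w in
  let en n (w : T n) := rvec (eps n) w in
  let Y n (w : T n) := response eta (D n) (bn n w) (en n w) in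
  let L1 n (w : T n) := loss1 J eta (D n) (lambda n) (Sigma n) (bn n w) (en n w) in
  let L3 n (w : T n) := loss3 J eta (D n) (lambda n) (Sigma n) (bn n w) (en n w) in
  let R1 n := fine ('E_(P n)[L1 n])%E in
  let R3 n := fine ('E_(P n)[L3 n])%E in
  let U n (w : T n) := score_U J (D n) (lambda n) (Sigma n) (Y n w) sigma2 in
  let V n (w : T n) := score_V J (D n) (lambda n) (Sigma n) (Y n w) in
  let err n (w : T n) := n%:R^-1 * ((en n w)^T *m en n w) 0 0 in
  (exists K : R, forall n (a : R),
     eigenvalue (Sigma n
       *m invmx ((Z n)^T *m (1%:M - A0 n) *m Z n + Sigma n) *m Sigma n) a ->
     a <= K) ->
  (fun n => n%:R * R1 n) @ \oo --> +oo ->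
  (fun n => R1 n - R3 n) =o_\oo R1 ->
  is_op P (fun n w => U n w - L3 n w - err n w) L3 /\
  ((fun n => (n%:R^-1 * \tr (A n)) ^+ 2 / (n%:R^-1 * \tr (A n *m A n)))
     @ \oo --> (0 : R) ->
   is_op P (fun n w => V n w - L3 n w - err n w) L3).
Proof.
move=> HJ Hxi s20 bB [KB BK] epsN ind _ lam0 Sig0 _ Z A0 A bn en Y L1 L3 R1 R3.
move=> U V err [K1 SK] nR1 R13.
pose kB := Num.max KB 0; pose k1 := Num.max K1 0.
have kB0 : 0 <= kB by rewrite le_max lexx orbT.
have k10 : 0 <= k1 by rewrite le_max lexx orbT.
have BkB n a : eigenvalue (B n) a -> a <= kB.
  by move=> /BK h; rewrite le_max (le_trans (ler_norm a) h).
have Sk1 n a : eigenvalue (Sigma n *m invmx ((Z n)^T *m (1%:M - A0 n) *m Z n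
    + Sigma n) *m Sigma n) a -> a <= k1.
  by move=> /SK h; rewrite le_max h.
have R1E : R1 = fun n => Ex (P n) (L1 n) by apply/funext => n; rewrite /R1 unlock.
have R3E : R3 = fun n => Ex (P n) (L3 n) by apply/funext => n; rewrite /R3 unlock.
pose c := 8 * (kB * k1 + sigma2) + 16 * sigma2 + 2 * sigma2 ^+ 2.
have ks0 : 0 <= 8 * (kB * k1 + sigma2).
  by rewrite mulr_ge0// addr_ge0 ?mulr_ge0// ltW.
have s160 : 0 <= 16 * sigma2 by rewrite mulr_ge0// ltW.
have s220 : 0 <= 2 * sigma2 ^+ 2 by rewrite mulr_ge0// sqr_ge0.
have mL1 n : mom (P n) 2 (L1 n).
  exact: (mom2_loss1 _ _ _ _ s20 (bB n) (epsN n) (ind n)).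
have mL3 n : measurable_fun setT (L3 n).
  exact: (measurable_loss3 _ _ _ _ s20 (bB n) (epsN n) (ind n)).
have L31 n w : 0 <= L3 n w <= L1 n w by exact: loss3_le.
have r0 n : 0 <= Ex (P n) (L1 n).
  by apply: Ex_ge0 => w; case/andP: (L31 n w); exact: le_trans.
have m2U n : mom (P n) 2 (fun w => U n w - L1 n w - err n w).
  exact: (mom2_excess _ HJ (Hxi n) s20 (bB n) (epsN n) (ind n) (lam0 n) (Sig0 n)).
have m2err n : mom (P n) 2 (fun w => err n w - sigma2).
  exact: (mom2_err s20 (bB n) (epsN n) (ind n)).
have varL1 n : Ex (P n) (fun w => (L1 n w - Ex (P n) (L1 n)) ^+ 2) <=
    c * Ex (P n) (L1 n) / n%:R.
  apply: le_trans (var_loss1 _ HJ (Hxi n) s20 (bB n) (epsN n) (ind n) (lam0 n) (Sig0 n)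
    kB0 k10 (BkB n) (Sk1 n)) _.
  by rewrite ler_wpM2r ?invr_ge0// ler_wpM2r// /c; lra.
have varU n : Ex (P n) (fun w => (U n w - L1 n w - err n w) ^+ 2) <=
    c * Ex (P n) (L1 n) / n%:R.
  apply: le_trans (var_excess _ HJ (Hxi n) s20 (bB n) (epsN n) (ind n) (lam0 n) (Sig0 n)) _.
  by rewrite ler_wpM2r ?invr_ge0// ler_wpM2r// /c; lra.
have varerr n : (0 < n)%N ->
    Ex (P n) (fun w => (err n w - sigma2) ^+ 2) <= c / n%:R.
  move=> n0; apply: le_trans (var_err s20 (bB n) (epsN n) (ind n) n0) _.
  by rewrite ler_wpM2r ?invr_ge0// /c; lra.
have nr : (fun n => n%:R * Ex (P n) (L1 n)) @ \oo --> +oo.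
  by move: nR1; rewrite R1E.
have r3o (e : R) : 0 < e -> \forall n \near \oo,
    `|Ex (P n) (L1 n) - Ex (P n) (L3 n)| <= e * `|Ex (P n) (L1 n)|.
  by move: R13; rewrite R1E R3E => /eqoP h e0; exact: h.
split; first exact: (U_is_op mL1 mL3 L31 m2U varL1 varU nr r3o).
move=> rho0.
apply: (V_is_op s20 mL1 mL3 L31 m2U m2err varL1 varU varerr nr r3o
  (m := fun n => n%:R^-1 * \tr (A n)) (m2 := fun n => n%:R^-1 * \tr (A n *m A n))).
- move=> n; exact: (measurable_score_V _ HJ (Hxi n) s20 (bB n) (epsN n) (ind n) (lam0 n) (Sig0 n)).
- near=> n => w; apply: score_VE; near: n; exact: nbhs_infty_gt.
- move=> n; exact: (trace_smoothing_sqr_le HJ (Hxi n) (lam0 n) (Sig0 n)).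
- move=> n; exact: (trace_smoothing_eq0 HJ (Hxi n) (lam0 n) (Sig0 n)).
- move=> n; exact: (trace_smoothing_risk _ HJ (Hxi n) s20 (bB n) (epsN n) (ind n) (lam0 n) (Sig0 n)).
- exact: rho0.
Unshelve. all: by end_near. Qed.
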